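(* Let $p\ge 1$ be real. If $T\subset\mathbb{R}^2$ is a (non-degenerate) triangle with one vertex at the origin, then $T$ is a maximizer for $F_p$ on $\mathcal{K}^2_0$, that is, $F_p(K)\le F_p(T)$ for every $K\in\mathcal{K}^2_0$.
   Context: A convex body in $\mathbb{R}^n$ is a non-empty compact convex subset of $\mathbb{R}^n$; its support function is $h_K(u)=\sup\{\langle x,u\rangle : x\in K\}$, $u\in\mathbb{R}^n$. For a real number $p\ge 1$ and convex bodies $K,L\subset\mathbb{R}^n$ both containing the origin, the $p$-sum $K+_pL$ is the convex body whose support function is $h_{K+_pL}(u)=\big(h_K(u)^p+h_L(u)^p\big)^{1/p}$, $u\in\mathbb{R}^n$. Write $-K=\{-x: x\in K\}$ and let $V_2$ denote area (two-dimensional Lebesgue measure). $\mathcal{K}^2_0$ denotes the set of convex bodies in $\mathbb{R}^2$ with non-empty interior and containing the origin. For $K\in\mathcal{K}^2_0$, $$F_p(K)=\frac{V_2\big(K+_p(-K)\big)}{V_2(K)}.$$ *)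

(* Defs.v *)
From HB Require Import structures.
From mathcomp Require Import all_boot all_order all_algebra.
From mathcomp Require Import all_classical all_reals all_analysis.

Set Implicit Arguments.
Unset Strict Implicit.
Unset Printing Implicit Defensive.

Import Order.TTheory GRing.Theory Num.Theory.
Import numFieldNormedType.Exports.

Local Open Scope classical_set_scope.
Local Open Scope ring_scope.

Section PlanarConvexBodies.
Context {R : realType}.
Implicit Types (K L : set (R * R)) (x u a b c : R * R) (p : R).

Definition dot x u : R := x.1 * u.1 + x.2 * u.2.

Definition convex_body K : Prop :=
  [/\ K !=set0, compact K & convex_set K].

Definition support K u : R := sup [set dot x u | x in K].

Definition is_psum p K L : set (set (R * R)) := [set M | convex_body M /\
  forall u, support M u = (support K u `^ p + support L u `^ p) `^ p^-1].

(* [is_psum p K L] has exactly one element when 1 <= p and K, L are convex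
   bodies containing the origin; [psum] is only meaningful in that case. *)
Definition psum p K L : set (R * R) := xget set0 (is_psum p K L).

Definition area : set (R * R) -> \bar R :=
  (@lebesgue_measure R \x @lebesgue_measure R)%E.

Definition K02 : set (set (R * R)) :=
  [set K | [/\ convex_body K, interior K !=set0 & K (0, 0)]].

(* Convex bodies have finite area, so [fine] loses nothing on [K02]. *)
Definition Fp p K : R :=
  fine (area (psum p K (-%R @` K))) / fine (area K).

Definition collinear a b c : Prop := exists u (t : R),
  [/\ u != (0, 0), dot a u = t, dot b u = t & dot c u = t].

Definition convex_hull K : set (R * R) :=
  smallest (fun L => convex_set L) K.

Definition is_triangle a b c T : Prop :=
  ~ collinear a b c /\ T = convex_hull [set a; b; c].

Definition maximizer (F : set (R * R) -> R) (D : set (set (R * R))) K : Prop :=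
  D K /\ forall L, D L -> F L <= F K.

End PlanarConvexBodies.

(* Main.v *)
(** The p-difference body of [K] is the union of the sets [s K - t K] over the
    pairs [(s, t)] in the nonnegative part of the unit ball of the norm dual to
    l_p.  This description commutes with linear maps and is compatible with sums
    taken fiberwise along vertical lines, so [K |-> V(K +_p (-K))] is subadditive
    for fiberwise sums: the sections are segments, and the length of a sum of
    segments is the sum of the lengths.

    Call [C] the value of [F_p] at triangles with a vertex at the origin; all of
    these are linear images of one another.  A body between two vertical support
    lines, which contains the origin on the first one and, after a shear, a
    point of the horizontal axis on the second one, is the fiberwise sum of the
    parts above and below the axis.  The height function of each part is concave
    on an interval, hence a uniform limit of nonnegative combinations of tents,
    and the region under a tent is a triangle with a vertex at the origin.
    Subadditivity gives [V(K +_p (-K)) <= C V(K)].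

    If the origin is any point of [K], write it as a convex combination of the end
    points of its vertical chord.  Then [K] is contained in the same fiberwise
    combination of two vertical translates of [K] with the origin on the
    boundary, where a linear map makes a support line vertical. *)
Require Import Defs.
From mathcomp Require Import all_boot all_order all_algebra.
From mathcomp Require Import all_classical all_reals all_analysis.
From mathcomp Require Import measurable_realfun zify ring lra.
Set Implicit Arguments.
Unset Strict Implicit.
Unset Printing Implicit Defensive.
Import Order.TTheory GRing.Theory Num.Theory.
Import numFieldNormedType.Exports.
Local Open Scope classical_set_scope.
Local Open Scope ring_scope.

(** * Areas of planar convex sets *)

Section Plane.
Context {R : realType}.
Implicit Types (K M N : set (R * R)).

(** Convexity with two plain real weights in place of the interval-typed weight of [convex_set]. *)
Definition cvx K := forall x y (l m : R), K x -> K y -> 0 <= l -> 0 <= m ->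
  l + m = 1 -> K (l * x.1 + m * y.1, l * x.2 + m * y.2).

Lemma convex_setP K : convex_set (R := R) (M := (R * R)%type) K <-> cvx K.
Proof.
split=> [cK [x1 x2] [y1 y2] l m Kx Ky l0 m0 lm|cK x y l].
  have l1 : l <= 1 by lra.
  pose l' : {i01 R} := (Itv01 l0 l1).
  have := cK (x1, x2) (y1, y2) l'.
  rewrite !inE => /(_ Kx Ky).
  rewrite /conv /= /GRing.scale/=.
  have -> : m = 1 - l by lra.
  exact.
rewrite !inE => Kx Ky.
have := cK x y l%:num (1 - l%:num) Kx Ky.
apply => //.
by rewrite addrC subrK.
Qed.

(** The rational open boxes inside [A] are countably many and cover [A]. *)
Lemma open_prod_measurable (A : set (R * R)) : open A -> measurable A.
Proof.
move=> oA.
pose F (q : (rat * rat) * (rat * rat)) : set (R * R) :=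
  `]ratr q.1.1, ratr q.1.2[%classic `*` `]ratr q.2.1, ratr q.2.2[%classic.
pose I := [set q | F q `<=` A].
have -> : A = \bigcup_(q in I) F q.
  rewrite eqEsubset; split => [[x y] Axy|z [q Iq] Fz]; last exact: Iq.
  have : nbhs (x, y) A by apply: open_nbhs_nbhs.
  case=> -[U V] /= [xU yV] UVA.
  have box (z : R) (W : set R) : nbhs z W -> exists q : rat * rat,
      ratr q.1 < z < ratr q.2 /\ `]ratr q.1, ratr q.2[%classic `<=` W.
    move=> /nbhs_ballP [e e0 eW].
    have [|a] := @rat_in_itvoo R (z - e) z; first by rewrite ltrBlDr ltrDl.
    rewrite in_itv/= => /andP[a1 a2].
    have [|b] := @rat_in_itvoo R z (z + e); first by rewrite ltrDl.
    rewrite in_itv/= => /andP[b1 b2].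
    exists (a, b); split; first by rewrite /= a2 b1.
    move=> t /=; rewrite in_itv/= => /andP[t1 t2]; apply: eW.
    by rewrite /ball/= ltr_distlC; apply/andP; split; lra.
  have [q1 [xq1 q1U]] := box _ _ xU.
  have [q2 [yq2 q2V]] := box _ _ yV.
  exists (q1, q2) => /=.
    move=> [u v] [/= Hu Hv]; apply: UVA; split => /=; [exact: q1U|exact: q2V].
  by split; rewrite /= in_itv.
rewrite bigcup_mkcond; apply: countable_bigcupT_measurable.
  exact: countableP.
move=> q; case: ifPn => // _.
by apply: measurableX; exact: measurable_itv.
Qed.

Lemma prod_hausdorff : hausdorff_space (R * R)%type.
Proof. exact: (@norm_hausdorff R (R * R)%type). Qed.

Lemma compact_prod_measurable K : compact K -> measurable K.
Proof.
move=> /(compact_closed prod_hausdorff) /closed_openC /open_prod_measurable.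
by move=> /measurableC; rewrite setCK.
Qed.

Definition body K := compact K /\ cvx K.

Lemma compact_interval (S : set R) : compact S -> is_interval S ->
  S = set0 \/ exists a b, a <= b /\ S = `[a, b]%classic.
Proof.
move=> cS iS; have [->|/set0P S0] := eqVneq S set0; [by left|right].
have ci : {within S, continuous (@id R)}.
  by apply: continuous_subspaceT => x; exact: cvg_id.
have [a Sa aS] := compact_EVT_min S0 cS ci.
have [b Sb bS] := compact_EVT_max S0 cS ci.
rewrite inE in Sa; rewrite inE in Sb.
exists a, b; split; first by apply: aS; rewrite inE.
rewrite eqEsubset; split => x /=.
  by move=> Sx; rewrite in_itv/= aS ?bS ?inE.
by rewrite in_itv/= => ?; apply: (iS _ _ Sa Sb).
Qed.

Lemma compact_xsection K x : compact K -> compact (xsection K x).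
Proof.
move=> cK.
have -> : xsection K x = snd @` (K `&` [set z | z.1 = x]).
  rewrite eqEsubset; split => [y /xsectionP Ky|_ [[u v] [Ku /= ux] <-]] /=.
    by exists (x, y).
  by apply/xsectionP; rewrite -ux.
apply: continuous_compact.
  by apply: continuous_subspaceT => z; exact: cvg_snd.
apply: compact_closedI => //.
apply: (@closed_comp _ _ fst [set x]); last first.
  exact: (compact_closed (@Rhausdorff R) (@compact_set1 _ x)).
by move=> z _; exact: cvg_fst.
Qed.

Lemma body_xsection K x : body K -> xsection K x = set0 \/
  exists a b, a <= b /\ xsection K x = `[a, b]%classic.
Proof.
move=> [cK vK]; apply: compact_interval; first exact: compact_xsection.
move=> a b /xsectionP Ka /xsectionP Kb z /andP[az zb]; apply/xsectionP.
have [ab|ab] := eqVneq a b; first by have -> : z = a by lra.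
have ba : 0 < b - a by rewrite subr_gt0 lt_neqAle ab; lra.
have := vK _ _ ((b - z) / (b - a)) ((z - a) / (b - a)) Ka Kb.
rewrite /=.
have -> : (b - z) / (b - a) * x + (z - a) / (b - a) * x = x by field; lra.
have -> : (b - z) / (b - a) * a + (z - a) / (b - a) * b = z by field; lra.
apply.
- by apply: divr_ge0; lra.
- by apply: divr_ge0; lra.
- by field; lra.
Qed.

Definition seclen K (x : R) : \bar R := lebesgue_measure (xsection K x).

Lemma lebesgue_itv (a b : R) : a <= b ->
  lebesgue_measure (`[a, b]%classic : set R) = (b - a)%:E.
Proof.
move=> ab; rewrite lebesgue_measure_itv/= lte_fin.
by case: ltgtP ab => // -> _; rewrite subrr.
Qed.

(** All comparisons of areas below go through this: it suffices to compare the lengths of vertical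
    sections. *)
Lemma areaE K : area K = (\int[lebesgue_measure]_x seclen K x)%E.
Proof. by []. Qed.

Lemma measurable_seclen K : compact K -> measurable_fun setT (seclen K).
Proof.
move=> /compact_prod_measurable mK.
exact: (measurable_fun_xsection (@lebesgue_measure R) mK).
Qed.

Lemma compact_box K : compact K -> exists c : R, 0 < c /\
  forall z, K z -> (- c <= z.1 <= c) /\ (- c <= z.2 <= c).
Proof.
move=> cK.
have [M [_ Mb]] := compact_bounded cK.
exists (`|M| + 1); split; first by rewrite ltr_wpDl.
move=> z Kz; have := Mb (`|M| + 1) (ltr_pwDr ltr01 (ler_norm _)) z Kz.
rewrite /= /Num.norm/= ge_max => /andP[z1 z2].
by rewrite -!ler_norml.
Qed.

Lemma le_area K M : compact K -> compact M -> K `<=` M -> (area K <= area M)%E.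
Proof.
move=> /compact_prod_measurable mK /compact_prod_measurable mM KM.
exact: (@le_measure _ _ _ (lebesgue_measure \x lebesgue_measure)%E K M
  (mem_set mK) (mem_set mM) KM).
Qed.

Lemma area_fin K : compact K -> area K \is a fin_num.
Proof.
move=> cK; rewrite ge0_fin_numE; last exact: integral_ge0.
have [c [c0 Kc]] := compact_box cK.
pose B : set (R * R) := `[- c, c]%classic `*` `[- c, c]%classic.
have cB : compact B by apply: compact_setX; exact: segment_compact.
have KB : K `<=` B by move=> z /Kc[? ?]; split; rewrite /= in_itv.
apply: (le_lt_trans (le_area cK cB KB)).
have cc : - c <= c by lra.
have -> : area B = ((c - - c)%:E * (c - - c)%:E)%E.
  rewrite -(lebesgue_itv cc).
  exact: (product_measure1E (@lebesgue_measure R) (@lebesgue_measure R)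
    (measurable_itv `[- c, c]) (measurable_itv `[- c, c])).
by rewrite -EFinM ltry.
Qed.

Definition rarea K : R := fine (area K).

Lemma rareaE K : compact K -> (rarea K)%:E = area K.
Proof. by move=> cK; rewrite fineK// area_fin. Qed.

Lemma rarea_ge0 K : 0 <= rarea K.
Proof. by rewrite fine_ge0// integral_ge0. Qed.

Lemma le_rarea K M : compact K -> compact M -> K `<=` M -> rarea K <= rarea M.
Proof. by move=> cK cM KM; rewrite -lee_fin !rareaE// le_area. Qed.

Lemma le_rarea_sections K M N : compact K -> compact M -> compact N ->
  (forall x, seclen K x <= seclen M x + seclen N x)%E -> rarea K <= rarea M + rarea N.
Proof.
move=> cK cM cN KMN; rewrite -lee_fin EFinD !rareaE// !areaE.
rewrite -ge0_integralD//=; try exact: measurable_seclen.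
apply: ge0_le_integral => //=.
- exact: measurable_seclen.
- by apply: emeasurable_funD; exact: measurable_seclen.
Qed.

Lemma rarea_sections_add K M N : compact K -> compact M -> compact N ->
  (forall x, seclen K x = seclen M x + seclen N x)%E -> rarea K = rarea M + rarea N.
Proof.
move=> cK cM cN KMN; apply: EFin_inj; rewrite EFinD !rareaE// !areaE.
rewrite -ge0_integralD//=; try exact: measurable_seclen.
by apply: eq_integral => x _.
Qed.

Lemma rarea_sections_scale K M (c : R) : 0 <= c -> compact K -> compact M ->
  (forall x, seclen M x = c%:E * seclen K x)%E -> rarea M = c * rarea K.
Proof.
move=> c0 cK cM KM; apply: EFin_inj; rewrite EFinM !rareaE// !areaE.
rewrite -ge0_integralZl_EFin//=; try exact: measurable_seclen.
by apply: eq_integral => x _.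
Qed.

End Plane.

(** * Linear maps *)

Section Continuity.
Context {R : realType} {T : topologicalType}.
Implicit Types f g : T -> R.

Lemma continuous_add f g : continuous f -> continuous g ->
  continuous (fun x => f x + g x).
Proof. by move=> cf cg x; apply: cvgD; [exact: cf|exact: cg]. Qed.

Lemma continuous_mul f g : continuous f -> continuous g ->
  continuous (fun x => f x * g x).
Proof. by move=> cf cg x; apply: cvgM; [exact: cf|exact: cg]. Qed.

Lemma continuous_opp f : continuous f -> continuous (fun x => - f x).
Proof. by move=> cf x; apply: cvgN; exact: cf. Qed.

Lemma continuous_const (U : topologicalType) (c : U) : continuous (fun _ : T => c).
Proof. by move=> x; exact: cvg_cst. Qed.

Lemma continuous_mkpair f g : continuous f -> continuous g ->
  continuous (fun x => (f x, g x)).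
Proof. by move=> cf cg x; exact: (cvg_pair (cf x) (cg x)). Qed.

Lemma continuous_fst_comp (U V : topologicalType) (h : T -> (U * V)%type) :
  continuous h -> continuous (fun x => (h x).1).
Proof. by move=> ch x; apply: continuous_comp; [exact: ch|exact: cvg_fst]. Qed.

Lemma continuous_snd_comp (U V : topologicalType) (h : T -> (U * V)%type) :
  continuous h -> continuous (fun x => (h x).2).
Proof. by move=> ch x; apply: continuous_comp; [exact: ch|exact: cvg_snd]. Qed.

End Continuity.

Ltac solve_continuous :=
  lazymatch goal with
  | |- forall x, continuous_at x (fun w => (_, _)) =>
    apply: continuous_mkpair; solve_continuous
  | |- forall x, continuous_at x (fun w => _ + _) =>
    apply: continuous_add; solve_continuous
  | |- forall x, continuous_at x (fun w => _ * _) =>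
    apply: continuous_mul; solve_continuous
  | |- forall x, continuous_at x (fun w => - _) =>
    apply: continuous_opp; solve_continuous
  | |- forall x, continuous_at x (fun w => fst w) => move=> ?; exact: cvg_fst
  | |- forall x, continuous_at x (fun w => snd w) => move=> ?; exact: cvg_snd
  | |- forall x, continuous_at x fst => move=> ?; exact: cvg_fst
  | |- forall x, continuous_at x snd => move=> ?; exact: cvg_snd
  | |- forall x, continuous_at x (fun w => fst _) =>
    apply: continuous_fst_comp; solve_continuous
  | |- forall x, continuous_at x (fun w => snd _) =>
    apply: continuous_snd_comp; solve_continuous
  | |- _ => exact: continuous_const
  end.

Section Maps.
Context {R : realType}.
Implicit Types (K M N B : set (R * R)).

Lemma compact_image_continuous (T U : topologicalType) (f : T -> U) (A : set T) :
  continuous f -> compact A -> compact (f @` A).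
Proof. by move=> cf cA; apply: continuous_compact => //; exact: continuous_subspaceT. Qed.

Lemma closed_le_fun (T : topologicalType) (f g : T -> R) :
  continuous f -> continuous g -> closed [set x | f x <= g x].
Proof.
move=> cf cg.
have -> : [set x | f x <= g x] = (fun x => g x + - f x) @^-1` [set y | 0 <= y].
  by apply/seteqP; split => x /=; rewrite subr_ge0.
apply: closed_comp; last exact: closed_ge.
by move=> x _; apply: (continuous_add cg (continuous_opp cf)).
Qed.

Definition lin (a b c d : R) (z : R * R) : R * R :=
  (a * z.1 + b * z.2, c * z.1 + d * z.2).

Definition vaffine (c m v : R) (z : R * R) : R * R := (z.1, c * z.2 + m * z.1 + v).

Definition swap_coord (z : R * R) : R * R := (z.2, z.1).

Lemma body_lin a b c d K : body K -> body (lin a b c d @` K).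
Proof.
move=> [cK vK]; split.
  by apply: compact_image_continuous => //; rewrite /lin; solve_continuous.
move=> _ _ l m [x Kx <-] [y Ky <-] l0 m0 lm.
exists (l * x.1 + m * y.1, l * x.2 + m * y.2); first exact: vK.
by rewrite /lin /=; congr pair; ring.
Qed.

Lemma body_vaffine c m v K : body K -> body (vaffine c m v @` K).
Proof.
move=> [cK vK]; split.
  by apply: compact_image_continuous => //; rewrite /vaffine; solve_continuous.
move=> _ _ l n [x Kx <-] [y Ky <-] l0 m0 lm.
exists (l * x.1 + n * y.1, l * x.2 + n * y.2); first exact: vK.
have nE : n = 1 - l by lra.
by rewrite /vaffine nE /=; congr pair; ring.
Qed.

Lemma body_swap K : body K -> body (swap_coord @` K).
Proof.
move=> [cK vK]; split.
  by apply: compact_image_continuous => //; rewrite /swap_coord; solve_continuous.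
move=> _ _ l n [x Kx <-] [y Ky <-] l0 m0 lm.
by exists (l * x.1 + n * y.1, l * x.2 + n * y.2); first exact: vK.
Qed.

(** Each vertical section undergoes an affine map of slope [c]. The case [c = 0], where sections
    collapse to points, is included; it serves later to show that flat bodies contribute nothing. *)
Lemma rarea_vaffine c m v K : body K -> rarea (vaffine c m v @` K) = `|c| * rarea K.
Proof.
move=> bK; have bM := body_vaffine c m v bK.
apply: rarea_sections_scale; [exact: normr_ge0|exact: bK.1|exact: bM.1|] => x.
have E : xsection (vaffine c m v @` K) x =
    (fun y => c * y + m * x + v) @` xsection K x.
  rewrite eqEsubset; split => [y /xsectionP [[u w] Ku [ux wy]]|_ [y /xsectionP Ky <-]].
    by exists w; [apply/xsectionP; rewrite -ux|rewrite -ux -wy].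
  by apply/xsectionP; exists (x, y).
rewrite /seclen E {E}.
have [->|[a [b [ab ->]]]] := body_xsection x bK.
  by rewrite image_set0 measure0 mule0.
rewrite (lebesgue_itv ab).
have F (p q : R) : p <= q ->
   (forall y : R, p <= y <= q <-> exists2 z, a <= z <= b & c * z + m * x + v = y) ->
   [set c * y + m * x + v | y in `[a, b]] = `[p, q]%classic.
  move=> _ pq; rewrite eqEsubset; split => [y [z]|y]; rewrite /= in_itv/=.
    by move=> zab yE; rewrite in_itv/=; apply/pq; exists z.
  by move=> /pq [z zab zy]; exists z; rewrite //= in_itv.
have [c0|c0|c0] := ltgtP c 0.
- rewrite (F (c * b + m * x + v) (c * a + m * x + v)).
  + rewrite lebesgue_itv; last by rewrite !lerD2r ler_nM2l.
    by rewrite -EFinM ltr0_norm//; congr EFin; ring.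
  + by rewrite !lerD2r ler_nM2l.
  + move=> y; split=> [/andP[y1 y2]|[z /andP[z1 z2] <-]].
      exists ((y - m * x - v) / c); last by field; lra.
      by apply/andP; split; rewrite ?ler_ndivlMr ?ler_ndivrMr//; lra.
    by rewrite !lerD2r !ler_nM2l// z1 z2.
- rewrite (F (c * a + m * x + v) (c * b + m * x + v)).
  + rewrite lebesgue_itv; last by rewrite !lerD2r ler_pM2l.
    by rewrite -EFinM gtr0_norm//; congr EFin; ring.
  + by rewrite !lerD2r ler_pM2l.
  + move=> y; split=> [/andP[y1 y2]|[z /andP[z1 z2] <-]].
      exists ((y - m * x - v) / c); last by field; lra.
      by apply/andP; split; rewrite ?ler_pdivlMr ?ler_pdivrMr//; lra.
    by rewrite !lerD2r !ler_pM2l// z1 z2.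
- rewrite (F (m * x + v) (m * x + v)) //.
  + by rewrite lebesgue_itv// c0 normr0 mul0e subrr.
  + move=> y; rewrite c0; split=> [/andP[y1 y2]|[z _ <-]].
      by exists a; rewrite ?lexx// mul0r; lra.
    by rewrite mul0r add0r lexx.
Qed.

(** Swapping exchanges the two orders of integration, and the two product measures coincide because
    they agree on measurable rectangles. *)
Lemma rarea_swap K : body K -> rarea (swap_coord @` K) = rarea K.
Proof.
move=> bK; have bM := body_swap bK.
rewrite /rarea; congr fine.
have mK := compact_prod_measurable bK.1.
transitivity ((@lebesgue_measure R \x^ @lebesgue_measure R)%E K).
  rewrite areaE /product_measure2; apply: eq_integral => x _.
  rewrite /seclen /=; congr (_ _).
  rewrite eqEsubset; split => [y /xsectionP [[u w] Ku [ux wy]]|y /ysectionP Ky].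
    by apply/ysectionP; rewrite -ux -wy.
  by apply/xsectionP; exists (y, x).
apply/esym; apply: (@product_measure_unique _ _ _ _ _ (@lebesgue_measure R)
  (@lebesgue_measure R) (@lebesgue_measure R \x^ @lebesgue_measure R)%E) => //.
by move=> A C mA mC; apply: product_measure2E.
Qed.

Lemma rarea_lin a b c d K : body K -> a * d - b * c != 0 ->
  rarea (lin a b c d @` K) = `|a * d - b * c| * rarea K.
Proof.
move=> bK.
have gen a' b' c' d' M : body M -> a' != 0 ->
    rarea (lin a' b' c' d' @` M) = `|a' * d' - b' * c'| * rarea M.
  move=> bM a0.
  (* Gaussian elimination with pivot [a']: the matrix is a product of vertical maps and coordinate
     swaps. *)
  have -> : lin a' b' c' d' @` M = vaffine ((a' * d' - b' * c') / a') (c' / a') 0 @`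
     (swap_coord @` (vaffine a' b' 0 @` (swap_coord @` M))).
    rewrite !image_comp; apply: eq_imagel => -[x y] _ /=.
    by rewrite /lin /vaffine /swap_coord /=; congr pair; [ring|field].
  have b1 := body_swap bM; have b2 := body_vaffine a' b' 0 b1; have b3 := body_swap b2.
  rewrite rarea_vaffine// rarea_swap// rarea_vaffine// rarea_swap// mulrA -normrM.
  by congr (`|_| * _); field.
move=> D0; have [a0|a0] := eqVneq a 0; last exact: gen.
have c0 : c != 0.
  by apply: contraNneq D0 => ->; rewrite a0 mul0r mulr0 subrr.
have -> : lin a b c d @` K = swap_coord @` (lin c d a b @` K).
  by rewrite image_comp; apply: eq_imagel => -[x y] _.
rewrite rarea_swap; last exact: body_lin.
by rewrite gen// distrC [d * a]mulrC [c * b]mulrC.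
Qed.

Definition pdiff_map (w : (R * R) * ((R * R) * (R * R))) : R * R :=
  (w.1.1 * w.2.1.1 - w.1.2 * w.2.2.1, w.1.1 * w.2.1.2 - w.1.2 * w.2.2.2).

(* With [B := pdual p] below this is [K +_p (-K)], in the parametrization of the
   p-sum due to Lutwak, Yang and Zhang. *)
Definition pdiff B K : set (R * R) := pdiff_map @` (B `*` (K `*` K)).

Lemma pdiffP B K z : pdiff B K z <-> exists s t x y,
  [/\ B (s, t), K x, K y & z = (s * x.1 - t * y.1, s * x.2 - t * y.2)].
Proof.
split=> [[[[s t] [x y]] [/= Bst [Kx Ky]] <-]|[s [t [x [y [Bst Kx Ky ->]]]]]].
  by exists s, t, x, y; split.
by exists ((s, t), (x, y)).
Qed.

End Maps.

(** * Fiberwise sums and difference bodies *)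

Section DiffBody.
Context {R : realType}.
Implicit Types (K M N : set (R * R)).

(** The sections are segments, so splitting the two end points of a section of [K] already bounds
    its length by the sum of the other two lengths. *)
Lemma rarea_fiber_sum K M N : body K -> body M -> body N ->
  (forall x y, K (x, y) -> exists u v, [/\ M (x, u), N (x, v) & y = u + v]) ->
  rarea K <= rarea M + rarea N.
Proof.
move=> bK bM bN KMN; apply: le_rarea_sections; [exact: bK.1|exact: bM.1|exact: bN.1|].
move=> x; rewrite /seclen.
have [->|[a [b [ab Kab]]]] := body_xsection x bK.
  by rewrite measure0 adde_ge0.
have /xsectionP/KMN[u1 [v1 [Mu1 Nv1 au1]]] : xsection K x a.
  by rewrite Kab/= in_itv/= lexx.
have /xsectionP/KMN[u2 [v2 [Mu2 Nv2 bu2]]] : xsection K x b.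
  by rewrite Kab/= in_itv/= lexx ab.
rewrite Kab (lebesgue_itv ab).
have [M0|[c [d [cd Mcd]]]] := body_xsection x bM.
  by move/xsectionP : Mu1; rewrite M0.
have [N0|[e [f [ef Nef]]]] := body_xsection x bN.
  by move/xsectionP : Nv1; rewrite N0.
rewrite Mcd Nef (lebesgue_itv cd) (lebesgue_itv ef) -EFinD lee_fin.
have := Mu1; have := Mu2; have := Nv1; have := Nv2.
move=> /xsectionP; rewrite Nef/= in_itv/= => /andP[? ?].
move=> /xsectionP; rewrite Nef/= in_itv/= => /andP[? ?].
move=> /xsectionP; rewrite Mcd/= in_itv/= => /andP[? ?].
move=> /xsectionP; rewrite Mcd/= in_itv/= => /andP[? ?].
move=> {KMN Kab Mcd Nef Mu1 Mu2 Nv1 Nv2}; lra.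
Qed.

Variable B : set (R * R).
Hypothesis bB : body B.
Hypothesis B_ge0 : forall s t, B (s, t) -> 0 <= s /\ 0 <= t.

(** Convex combination with weights of arbitrary total; when the total is zero any point of [K]
    serves as [z]. *)
Lemma cvx_weighted K (a b : R) x y : cvx K -> K x -> K y -> 0 <= a -> 0 <= b ->
  exists z, [/\ K z, a * x.1 + b * y.1 = (a + b) * z.1
                & a * x.2 + b * y.2 = (a + b) * z.2].
Proof.
move=> vK Kx Ky a0 b0.
have [ab|ab] := eqVneq (a + b) 0.
  have -> : a = 0 by lra.
  have -> : b = 0 by lra.
  by exists x; split => //; ring.
exists (a / (a + b) * x.1 + b / (a + b) * y.1,
        a / (a + b) * x.2 + b / (a + b) * y.2); split => /=.
- apply: vK => //; [apply: divr_ge0; lra|apply: divr_ge0; lra|by field].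
- by field.
- by field.
Qed.

(** For convexity, the two points of [K] with weights [l * s1] and [m * s2] merge into one point
    with the summed weight, and likewise for [t]. This is where nonnegativity of the weights in [B]
    enters. *)
Lemma body_pdiff K : body K -> body (pdiff B K).
Proof.
move=> [cK vK]; split.
  apply: compact_image_continuous; first by rewrite /pdiff_map; solve_continuous.
  by apply: compact_setX; [exact: bB.1|exact: compact_setX].
move=> _ _ l m /pdiffP[s1 [t1 [x1 [y1 [B1 Kx1 Ky1 ->]]]]]
  /pdiffP[s2 [t2 [x2 [y2 [B2 Kx2 Ky2 ->]]]]] l0 m0 lm.
have [s10 t10] := B_ge0 B1; have [s20 t20] := B_ge0 B2.
have [x [Kx X1 X2]] := cvx_weighted vK Kx1 Kx2 (mulr_ge0 l0 s10) (mulr_ge0 m0 s20).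
have [y [Ky Y1 Y2]] := cvx_weighted vK Ky1 Ky2 (mulr_ge0 l0 t10) (mulr_ge0 m0 t20).
apply/pdiffP; exists (l * s1 + m * s2), (l * t1 + m * t2), x, y; split => //.
  exact: (bB.2 _ _ _ _ B1 B2).
by rewrite -X1 -X2 -Y1 -Y2 /=; congr pair; ring.
Qed.

Definition darea K : R := rarea (pdiff B K).

Lemma le_darea K M : body K -> body M -> K `<=` M -> darea K <= darea M.
Proof.
move=> bK bM KM; apply: le_rarea; [exact: (body_pdiff bK).1|exact: (body_pdiff bM).1|].
move=> z /pdiffP[s [t [x [y [Bst Kx Ky ->]]]]].
by apply/pdiffP; exists s, t, x, y; split => //; exact: KM.
Qed.

Lemma pdiff_lin a b c d K :
  pdiff B (lin a b c d @` K) = lin a b c d @` pdiff B K.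
Proof.
rewrite eqEsubset; split => z.
  move=> /pdiffP[s [t [_ [_ [Bst [x Kx <-] [y Ky <-] ->]]]]].
  exists (s * x.1 - t * y.1, s * x.2 - t * y.2).
    by apply/pdiffP; exists s, t, x, y.
  by rewrite /lin/=; congr pair; ring.
move=> [_ /pdiffP[s [t [x [y [Bst Kx Ky ->]]]]] <-].
apply/pdiffP; exists s, t, (lin a b c d x), (lin a b c d y); split => //.
by rewrite /lin/=; congr pair; ring.
Qed.

Lemma darea_lin a b c d K : body K -> a * d - b * c != 0 ->
  darea (lin a b c d @` K) = `|a * d - b * c| * darea K.
Proof. by move=> bK D0; rewrite /darea pdiff_lin rarea_lin//; exact: body_pdiff. Qed.

Lemma vaffine_lin c m K : vaffine c m 0 @` K = lin 1 0 m c @` K.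
Proof.
apply: eq_imagel => z _; rewrite /vaffine/lin; congr pair; ring.
Qed.

Lemma swap_lin K : swap_coord @` K = lin 0 1 1 0 @` K.
Proof.
apply: eq_imagel => z _; rewrite /swap_coord/lin; congr pair; ring.
Qed.

(** Unlike [darea_lin], this covers the singular case [c = 0]. There is no translation part, since
    [pdiff] commutes only with linear maps. *)
Lemma darea_vaffine c m K : body K -> darea (vaffine c m 0 @` K) = `|c| * darea K.
Proof.
move=> bK; rewrite /darea vaffine_lin pdiff_lin -vaffine_lin.
by apply: rarea_vaffine; exact: body_pdiff.
Qed.

Lemma darea_swap K : body K -> darea (swap_coord @` K) = darea K.
Proof.
move=> bK; rewrite /darea swap_lin pdiff_lin -swap_lin.
by apply: rarea_swap; exact: body_pdiff.
Qed.

(** A fiberwise splitting of [K] passes to [pdiff B K]: split both points of [K], and the two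
    resulting differences lie over the same abscissa. *)
Lemma darea_fiber_sum K M N : body K -> body M -> body N ->
  (forall x y, K (x, y) -> exists u v, [/\ M (x, u), N (x, v) & y = u + v]) ->
  darea K <= darea M + darea N.
Proof.
move=> bK bM bN KMN; apply: rarea_fiber_sum; try exact: body_pdiff.
move=> p q /pdiffP[s [t [[x1 x2] [[y1 y2] [Bst Kx Ky [-> ->]]]]]].
have [u [v [Mu Nv ->]]] := KMN _ _ Kx.
have [u' [v' [Mu' Nv' ->]]] := KMN _ _ Ky.
exists (s * u - t * u'), (s * v - t * v'); split.
- by apply/pdiffP; exists s, t, (x1, u), (y1, u').
- by apply/pdiffP; exists s, t, (x1, v), (y1, v').
- rewrite /=; ring.
Qed.

End DiffBody.

(** * Regions under a graph over the unit interval, and triangles *)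

Section Regions.
Context {R : realType}.
Implicit Types (K M N : set (R * R)) (f g : R -> R).

Definition std_triangle : set (R * R) := [set z | [/\ 0 <= z.1, 0 <= z.2 & z.1 + z.2 <= 1]].

Definition box (a b c d : R) : set (R * R) :=
  [set z | a <= z.1 <= b /\ c <= z.2 <= d].

Lemma boxE (a b c d : R) : box a b c d = `[a, b]%classic `*` `[c, d]%classic.
Proof.
by rewrite eqEsubset; split => z [z1 z2]; split; move: z1 z2;
  rewrite /= ?in_itv.
Qed.

Lemma body_box (a b c d : R) : body (box a b c d).
Proof.
split; first by rewrite boxE; apply: compact_setX; exact: segment_compact.
move=> [x1 x2] [y1 y2] l m [/= /andP[? ?] /andP[? ?]] [/= /andP[? ?] /andP[? ?]] l0 m0 lm.
by split; apply/andP; split => /=; nra.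
Qed.

Lemma closed_halfplane (a b c d : R) : closed [set z : R * R | a * z.1 + b * z.2 + c <= d].
Proof. by apply: closed_le_fun; solve_continuous. Qed.

Lemma body_halfplane K (a b c d : R) : body K ->
  body (K `&` [set z | a * z.1 + b * z.2 + c <= d]).
Proof.
move=> [cK vK]; split; first by apply: compact_closedI => //; exact: closed_halfplane.
move=> x y l m [Kx /= x1] [Ky /= y1] l0 m0 lm; split; first exact: vK.
rewrite /= in x1 y1 *.
have : l * (a * x.1 + b * x.2 + c) + m * (a * y.1 + b * y.2 + c) <= (l + m) * d.
  by rewrite mulrDl lerD// ler_wpM2l.
rewrite lm mul1r; apply: le_trans.
rewrite le_eqVlt; apply/orP; left; apply/eqP.
have mE : m = 1 - l by move=> {x1 y1}; lra.
by rewrite mE; ring.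
Qed.

Lemma body_std_triangle : body std_triangle.
Proof.
have -> : std_triangle = box 0 1 0 1 `&` [set z | 1 * z.1 + 1 * z.2 + 0 <= 1].
  rewrite eqEsubset; split => [[x y] [/= x0 y0 xy]|].
    by split => /=; [split => /=; apply/andP; split; lra|lra].
  by move=> [x y] [[/= /andP[? ?] /andP[? ?]] /= ?]; split => //=; lra.
by apply: body_halfplane; exact: body_box.
Qed.

Lemma rarea_box (a b c d : R) : a <= b -> c <= d ->
  rarea (box a b c d) = (b - a) * (d - c).
Proof.
move=> ab cd; apply: EFin_inj; rewrite rareaE; last exact: (body_box _ _ _ _).1.
rewrite EFinM -(lebesgue_itv ab) -(lebesgue_itv cd) boxE.
exact: (product_measure1E (@lebesgue_measure R) (@lebesgue_measure R)
    (measurable_itv `[a, b]) (measurable_itv `[c, d])).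
Qed.

Lemma rarea_std_triangle_gt0 : 0 < rarea std_triangle.
Proof.
have h : (0 : R) <= 1 / 2 by lra.
apply: (@lt_le_trans _ _ (rarea (box 0 (1 / 2) 0 (1 / 2)))).
  by rewrite rarea_box//; lra.
apply: le_rarea; [exact: (body_box _ _ _ _).1|exact: body_std_triangle.1|].
move=> [x y] [/= /andP[? ?] /andP[? ?]].
by split => /=; lra.
Qed.

Definition fiber_sum M N : set (R * R) :=
  [set z | exists u v, [/\ M (z.1, u), N (z.1, v) & z.2 = u + v]].

Lemma body_fiber_sum M N : body M -> body N -> body (fiber_sum M N).
Proof.
move=> [cM vM] [cN vN].
split; last first.
  move=> x y l m [u [v [Mu Nv xE]]] [u' [v' [Mu' Nv' yE]]] l0 m0 lm.
  exists (l * u + m * u'), (l * v + m * v'); split => /=.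
  - exact: (vM (x.1, u) (y.1, u')).
  - exact: (vN (x.1, v) (y.1, v')).
  - by rewrite xE yE; ring.
pose ph (w : (R * R) * (R * R)) : R * R := (w.1.1, w.1.2 + w.2.2).
(* Compactness: the fiberwise sum is a continuous image of the pairs with equal abscissas, a closed
   condition written as two inequalities. *)
have -> : fiber_sum M N = ph @` ((M `*` N) `&`
    ([set w | w.1.1 <= w.2.1] `&` [set w | w.2.1 <= w.1.1])).
  rewrite eqEsubset; split.
    move=> [x y] [u [v [/= Mu Nv ->]]]; exists ((x, u), (x, v)); last by [].
    by split; [|split; rewrite /= lexx].
  move=> _ [[[x u] [x' v]] [[/= Mu Nv] [/= l1 l2]] <-].
  have xE : x' = x by apply/eqP; rewrite eq_le l1 l2.
  by exists u, v; split => //=; rewrite -xE.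
apply: compact_image_continuous; first by rewrite /ph; solve_continuous.
apply: compact_closedI; first exact: compact_setX.
by apply: closedI; apply: closed_le_fun; solve_continuous.
Qed.

Definition hypo f : set (R * R) := [set z | 0 <= z.1 <= 1 /\ 0 <= z.2 <= f z.1].

Lemma xsection_hypo f x : 0 <= x <= 1 -> xsection (hypo f) x = `[0, f x]%classic.
Proof.
move=> x01; rewrite eqEsubset; split => y.
  by move=> /xsectionP[_ /=]; rewrite in_itv.
by rewrite /= in_itv/= => y01; apply/xsectionP; split.
Qed.

Lemma xsection_hypo0 f x : ~~ (0 <= x <= 1) -> xsection (hypo f) x = set0.
Proof.
move=> x01; rewrite -subset0 => y /xsectionP[/=].
by rewrite (negbTE x01).
Qed.

Lemma hypo_add f g : (forall x, 0 <= x <= 1 -> 0 <= f x) ->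
  (forall x, 0 <= x <= 1 -> 0 <= g x) ->
  hypo (fun x => f x + g x) = fiber_sum (hypo f) (hypo g).
Proof.
move=> f0 g0; rewrite eqEsubset; split => -[x y].
  move=> [/= x01 /andP[y0 yfg]]; have := f0 _ x01; have := g0 _ x01 => gx fx.
  (* The first summand is filled up to height [f x]; the second takes the excess. *)
  have [yf|fy] := leP y (f x).
    exists y, 0; split => /=; last by lra.
    - by split => //=; rewrite y0.
    - by split => //=; rewrite lexx.
  exists (f x), (y - f x); split => /=; last by lra.
  - by split => //=; rewrite fx lexx.
  - by split => //=; apply/andP; split; lra.
move=> [u [v [[/= x01 /andP[u0 uf]] [_ /= /andP[v0 vg]] ->]]].
by split => //=; rewrite addr_ge0//= lerD.
Qed.

Lemma rarea_hypo_add f g : (forall x, 0 <= x <= 1 -> 0 <= f x) ->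
  (forall x, 0 <= x <= 1 -> 0 <= g x) -> body (hypo f) -> body (hypo g) ->
  rarea (hypo (fun x => f x + g x)) = rarea (hypo f) + rarea (hypo g).
Proof.
move=> f0 g0 bf bg; apply: rarea_sections_add; [|exact: bf.1|exact: bg.1|].
  by rewrite hypo_add//; exact: (body_fiber_sum bf bg).1.
move=> x; rewrite /seclen; have [x01|x01] := boolP (0 <= x <= 1); last first.
  by rewrite !xsection_hypo0// measure0 adde0.
have fx := f0 _ x01; have gx := g0 _ x01.
rewrite !xsection_hypo// (lebesgue_itv fx) (lebesgue_itv gx).
by rewrite (lebesgue_itv (addr_ge0 fx gx)) -EFinD !subr0.
Qed.

Variable B : set (R * R).
Hypothesis bB : body B.
Hypothesis B_ge0 : forall s t, B (s, t) -> 0 <= s /\ 0 <= t.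

(** The constant of the bound; by [darea_tri] it is the ratio at every nondegenerate triangle with a
    vertex at the origin. *)
Let Cp := darea B std_triangle / rarea std_triangle.

Lemma Cp_ge0 : 0 <= Cp.
Proof. by rewrite divr_ge0// rarea_ge0. Qed.

Lemma darea_tri a b c d : a * d - b * c != 0 ->
  darea B (lin a b c d @` std_triangle) = Cp * rarea (lin a b c d @` std_triangle).
Proof.
move=> D0; rewrite darea_lin//; last exact: body_std_triangle.
rewrite rarea_lin//; last exact: body_std_triangle.
by rewrite /Cp; field; rewrite gt_eqF// rarea_std_triangle_gt0.
Qed.

Definition good_height f := [/\ (forall x, 0 <= x <= 1 -> 0 <= f x), body (hypo f) &
  darea B (hypo f) <= Cp * rarea (hypo f)].

(** The area is additive in the height and [darea] is subadditive, so the inequality survives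
    addition. *)
Lemma good_height_add f g : good_height f -> good_height g ->
  good_height (fun x => f x + g x).
Proof.
move=> [f0 bf df] [g0 bg dg].
have bfg : body (hypo (fun x => f x + g x)) by rewrite hypo_add//; exact: body_fiber_sum.
split => //.
  by move=> x x01; rewrite addr_ge0 ?f0 ?g0.
rewrite rarea_hypo_add// mulrDr.
apply: (le_trans _ (lerD df dg)).
apply: darea_fiber_sum => // x y.
by rewrite hypo_add// => -[u [v [? ? ?]]]; exists u, v.
Qed.

Lemma good_height_eq f g : (forall x, 0 <= x <= 1 -> f x = g x) ->
  good_height f -> good_height g.
Proof.
move=> fg [f0 bf df].
have E : hypo g = hypo f.
  by rewrite eqEsubset; split => z [/= z1 z2]; split => //=; move: z2; rewrite fg.
split; rewrite ?E// => x x01.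
by rewrite -fg// f0.
Qed.

Lemma good_height_zero : good_height (fun _ => 0).
Proof.
have E : hypo (fun _ : R => 0) = box 0 1 0 0 by [].
split => //; first by rewrite E; exact: body_box.
have bS := body_box 0 1 0 (0 : R).
(* A horizontal segment is fixed by the vertical map of factor 0, so its [darea] vanishes. *)
have -> : hypo (fun _ : R => 0) = vaffine 0 0 0 @` box 0 1 0 0.
  rewrite E eqEsubset; split => [[x y] [/= H1 H2]|_ [[x y] [/= H1 H2] <-]].
    exists (x, y) => //; move/andP : H2 => [y0 y1].
    by rewrite /vaffine /=; congr pair; lra.
  by split => //=; rewrite !mul0r !addr0 lexx.
by rewrite darea_vaffine// normr0 mul0r mulr_ge0 ?Cp_ge0 ?rarea_ge0.
Qed.

(** The hypothesis says that the region under [f] is the triangle with vertices [(0, 0)], [(1, 0)],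
    [(w, h)], a linear image of [std_triangle]. Its form without division admits apexes over the end
    points, [w = 0] and [w = 1]. *)
Lemma good_height_tent (w h : R) f : 0 <= w <= 1 -> 0 < h ->
  (forall x y, 0 <= x <= 1 -> 0 <= y ->
     (y <= f x) = (y * w <= h * x) && (y * (1 - w) <= h * (1 - x))) -> good_height f.
Proof.
move=> /andP[w0 w1] h0 fE.
have E : hypo f = lin 1 w 0 h @` std_triangle.
  rewrite eqEsubset; split => [[x y] [/= x01 /andP[y0]]|_ [[a b] [/= a0 b0 ab] <-]].
    rewrite fE// => /andP[y1 y2].
    exists (x - w * (y / h), y / h).
      split => /=; [|by rewrite divr_ge0// ltW|].
      - by rewrite subr_ge0 mulrA ler_pdivrMr//; lra.
      - have : (y / h) * (1 - w) <= 1 - x by rewrite mulrAC ler_pdivrMr//; lra.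
        by move=> ?; lra.
    by rewrite /lin/=; congr pair; field; rewrite gt_eqF.
  have x01 : 0 <= 1 * a + w * b <= 1 by apply/andP; split; nra.
  have y0 : 0 <= 0 * a + h * b by rewrite mul0r add0r mulr_ge0// ltW.
  split => //=; rewrite y0 fE//=; apply/andP; split.
  - rewrite -subr_ge0.
    have -> : h * (1 * a + w * b) - (0 * a + h * b) * w = h * a by ring.
    by rewrite mulr_ge0// ltW.
  - rewrite -subr_ge0.
    have -> : h * (1 - (1 * a + w * b)) - (0 * a + h * b) * (1 - w) =
      h * (1 - (a + b)) by ring.
    by rewrite mulr_ge0 ?subr_ge0// ltW.
have D0 : 1 * h - w * 0 != 0 by rewrite mulr0 mul1r subr0 gt_eqF.
split.
- move=> x /[dup] x01 /andP[x0 x1]; rewrite fE// !mul0r.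
  by rewrite !mulr_ge0 ?subr_ge0// ltW.
- by rewrite E; exact/body_lin/body_std_triangle.
- by rewrite E darea_tri.
Qed.
End Regions.

(** * Concave height functions *)

Section Tents.
Context {R : realType}.
Implicit Types (f g : R -> R).

(** The Green function of minus the second derivative on the unit interval: its slope drops by
    exactly 1 at [w]. *)
Definition tent (w x : R) : R := Num.min (x * (1 - w)) (w * (1 - x)).

Lemma tent_left w x : x <= w -> tent w x = x * (1 - w).
Proof. by move=> xw; rewrite /tent min_l//; nra. Qed.

Lemma tent_right w x : w <= x -> tent w x = w * (1 - x).
Proof. by move=> xw; rewrite /tent min_r//; nra. Qed.

Variable m : nat.
Let n : R := m.+1%:R.

Let n_gt0 : 0 < n. Proof. by rewrite ltr0n. Qed.

Definition node (j : nat) : R := j%:R / n.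

Lemma node_le i j : (i <= j)%N -> node i <= node j.
Proof. by move=> ij; rewrite ler_pM2r ?invr_gt0// ler_nat. Qed.

Lemma nodeS j : node j.+1 = node j + n^-1.
Proof. by rewrite /node -natr1 mulrDl mul1r. Qed.

Lemma node0 : node 0 = 0. Proof. by rewrite /node mul0r. Qed.

Lemma node_last : node m.+1 = 1.
Proof. by rewrite /node divff// gt_eqF. Qed.

(** Away from its peak the tent is affine; at the peak the unit drop of the slope acts over a step
    of length [n^-1]. *)
Lemma tent_second_difference i j :
  tent (node i.+1) (node j) + tent (node i.+1) (node j.+2)
    - 2 * tent (node i.+1) (node j.+1) = - (n^-1 * (i == j)%:R).
Proof.
case: (ltngtP i j) => ij.
- rewrite !tent_right; try by apply: node_le; lia.
  by rewrite !nodeS mulr0; ring.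
- rewrite !tent_left; try by apply: node_le; lia.
  by rewrite !nodeS mulr0; ring.
- rewrite -ij tent_left; last by apply: node_le; lia.
  rewrite tent_right; last by apply: node_le; lia.
  rewrite tent_left; last by apply: node_le; lia.
  by rewrite !nodeS mulr1; ring.
Qed.

(* The second difference of [tent (node i.+1)] along the nodes is [- 1 / n] at
   [node i.+1] and vanishes elsewhere, whence the coefficients. *)
Definition interp (F : nat -> R) (x : R) : R :=
  F 0%N * (1 - x) + F m.+1 * x +
  \sum_(i < m) n * (2 * F i.+1 - F i - F i.+2) * tent (node i.+1) x.

Lemma interp_node F j : (j <= m.+1)%N -> interp F (node j) = F j.
Proof.
pose E j := interp F (node j) - F j.
have E0 : E 0%N = 0.
  rewrite /E /interp node0 big1 => [|i _]; first by ring.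
  rewrite tent_left; last by rewrite divr_ge0// ltW.
  by rewrite mul0r mulr0.
have En : E m.+1 = 0.
  rewrite /E /interp node_last big1 => [|i _]; first by ring.
  rewrite tent_right; last first.
    by rewrite -node_last; apply: node_le; rewrite ltnS; exact: ltnW.
  by rewrite subrr !mulr0.
have E2 k : (k < m)%N -> E k.+2 = 2 * E k.+1 - E k.
  move=> km; apply/eqP; rewrite -subr_eq0; apply/eqP.
  (* Only the tent peaking at the middle node contributes, and it reproduces the second difference
     of [F] there. *)
  have S : \sum_(i < m) n * (2 * F i.+1 - F i - F i.+2) *
      (tent (node i.+1) (node k) + tent (node i.+1) (node k.+2)
    - 2 * tent (node i.+1) (node k.+1)) = - (2 * F k.+1 - F k - F k.+2).
    rewrite (bigD1 (Ordinal km))//= big1 => [|i ik].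
      rewrite tent_second_difference eqxx mulr1 addr0 mulrN mulrAC mulfV ?gt_eqF//.
      by rewrite mul1r.
    rewrite tent_second_difference.
    have -> : (i == k :> nat) = false by apply: negbTE; exact: ik.
    by rewrite mulr0 oppr0 mulr0.
  have S' : \sum_(i < m) n * (2 * F i.+1 - F i - F i.+2) *
      (tent (node i.+1) (node k) + tent (node i.+1) (node k.+2)
    - 2 * tent (node i.+1) (node k.+1)) =
    \sum_(i < m) n * (2 * F i.+1 - F i - F i.+2) * tent (node i.+1) (node k)
    + \sum_(i < m) n * (2 * F i.+1 - F i - F i.+2) * tent (node i.+1) (node k.+2)
    - 2 * \sum_(i < m) n * (2 * F i.+1 - F i - F i.+2) * tent (node i.+1) (node k.+1).
    rewrite mulr_sumr -big_split/= -sumrB; apply: eq_bigr => i _; ring.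
  rewrite S in S'.
  rewrite /E /interp.
  move: S'; set a := \sum_(_ < _) _; set b := \sum_(_ < _) _; set c := \sum_(_ < _) _ => S'.
  rewrite !nodeS.
  transitivity ((a + b - 2 * c) + (2 * F k.+1 - F k - F k.+2)); last by rewrite -S'; ring.
  by ring.
(* The interpolation error is an affine sequence vanishing at both ends. *)
have Elin k : (k <= m.+1)%N -> E k = k%:R * E 1%N /\ ((k < m.+1)%N -> E k.+1 = k.+1%:R * E 1%N).
  elim: k => [_|k IH km]; first by rewrite E0 mul0r mul1r.
  have [IH1 IH2] := IH (ltnW km).
  split; first exact: IH2.
  move=> km'; rewrite E2// IH1 IH2// -[k.+2%:R]natr1 -[k.+1%:R]natr1; ring.
have E1 : E 1%N = 0.
  have [H _] := Elin m.+1 (leqnn _).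
  by move/eqP: H; rewrite En eq_sym mulf_eq0 gt_eqF//= => /eqP.
move=> jm; have [H _] := Elin _ jm.
by apply/eqP; rewrite -subr_eq0; apply/eqP; rewrite -[LHS]/(E j) H E1 mulr0.
Qed.

(** All peaks are nodes, so within one cell every tent stays on one of its affine branches. *)
Lemma interp_cell F j (a b : R) : (j <= m)%N -> 0 <= a -> 0 <= b -> a + b = 1 ->
  interp F (a * node j + b * node j.+1) = a * F j + b * F j.+1.
Proof.
move=> jm a0 b0 ab.
rewrite -(@interp_node F j) ?(leqW jm)// -(@interp_node F j.+1)// /interp.
have aE : a = 1 - b by lra.
have nj := node_le (leqnSn j).
have lo : node j <= a * node j + b * node j.+1 by rewrite aE; nra.
have hi : a * node j + b * node j.+1 <= node j.+1 by rewrite aE; nra.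
rewrite [X in _ + X = _](_ : _ =
  a * (\sum_(i < m) n * (2 * F i.+1 - F i - F i.+2) * tent (node i.+1) (node j)) +
  b * (\sum_(i < m) n * (2 * F i.+1 - F i - F i.+2) * tent (node i.+1) (node j.+1))).
  by rewrite aE; ring.
rewrite !mulr_sumr -big_split/=; apply: eq_bigr => i _.
have [ij|ji] := leqP i.+1 j.
- have H := node_le ij.
  rewrite (tent_right (le_trans H lo)) (tent_right H) (tent_right (le_trans H nj)).
  by rewrite aE; ring.
- have H := node_le ji.
  rewrite (tent_left (le_trans hi H)) (tent_left H) (tent_left (le_trans nj H)).
  by rewrite aE; ring.
Qed.

Lemma cell_exists x : 0 <= x <= 1 -> exists j (a b : R),
  [/\ (j <= m)%N, 0 <= a, 0 <= b, a + b = 1 & x = a * node j + b * node j.+1].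
Proof.
move=> /andP[x0 x1].
have xn : 0 <= x * n by rewrite mulr_ge0// ltW.
have [j [jm jx xj]] : exists j, [/\ (j <= m)%N, j%:R <= x * n & x * n <= j.+1%:R].
  have /andP[t1 t2] := truncn_itv xn.
  have [tm|mt] := leqP (Num.truncn (x * n)) m.
    by exists (Num.truncn (x * n)); split => //; exact: ltW.
  (* The truncation exceeds [m] only at [x = 1], which is put in the last cell. *)
  exists m; split => //.
    by apply: le_trans t1; rewrite ler_nat ltnW.
  by rewrite -[leRHS]mul1r ler_pM2r.
exists j, (j.+1%:R - x * n), (x * n - j%:R); split => //; rewrite ?subr_ge0//.
  by rewrite -natr1; ring.
by rewrite nodeS /node -natr1; field; rewrite gt_eqF.
Qed.

End Tents.

(** * Concavity and uniform continuity of the height function of a body *)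

Section ConcaveRegion.
Context {R : realType}.
Variable f : R -> R.
Hypothesis f_ge0 : forall x : R, 0 <= x <= 1 -> 0 <= f x.
Hypothesis bf : body (hypo f).

Lemma hypo_concave (x y l m : R) : 0 <= x <= 1 -> 0 <= y <= 1 -> 0 <= l -> 0 <= m ->
  l + m = 1 -> l * f x + m * f y <= f (l * x + m * y).
Proof.
move=> x01 y01 l0 m0 lm.
have X : hypo f (x, f x) by split => //=; rewrite f_ge0//= lexx.
have Y : hypo f (y, f y) by split => //=; rewrite f_ge0//= lexx.
by have [_ /= /andP[_]] := bf.2 _ _ l m X Y l0 m0 lm.
Qed.

(** Upper semicontinuity comes from compactness: the part of the region at height at least [f x + e]
    projects to a compact set missing [x]. *)
Lemma hypo_usc (x e : R) : 0 <= x <= 1 -> 0 < e -> exists2 r : R, 0 < r &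
  forall y : R, 0 <= y <= 1 -> `|x - y| < r -> f y < f x + e.
Proof.
move=> x01 e0.
pose Q : set R := fst @` (hypo f `&` [set z | f x + e <= z.2]).
have cQ : compact Q.
  apply: compact_image_continuous; first by solve_continuous.
  by apply: compact_closedI; [exact: bf.1|apply: closed_le_fun; solve_continuous].
have oQ : open (~` Q) by apply: closed_openC; apply: compact_closed => //; exact: Rhausdorff.
have Qx : (~` Q) x.
  move=> [[x' y] [[_ /= /andP[_ yx]] /= fy] xE]; rewrite xE in yx.
  by move: (le_trans fy yx); rewrite gerDl leNgt e0.
have /nbhs_ballP[r r0 rQ] : nbhs x (~` Q) by apply: open_nbhs_nbhs.
exists r => // y y01 xy; rewrite ltNge; apply/negP => fy.
apply: (rQ y) => //.
by exists (y, f y) => //; split => //; split => //=; rewrite f_ge0//= lexx.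
Qed.

(** Lower semicontinuity comes from concavity: between [x] and an end point [c] of the interval, [f]
    lies above its chord. *)
Lemma hypo_lsc (x e : R) : 0 <= x <= 1 -> 0 < e -> exists2 r : R, 0 < r &
  forall y : R, 0 <= y <= 1 -> `|x - y| < r -> f x - e < f y.
Proof.
move=> x01 e0; have fx := f_ge0 x01; have f1 : 0 < f x + 1 by lra.
have side (c : R) : 0 <= c <= 1 -> x != c -> exists2 r : R, 0 < r &
    forall y : R, 0 <= y <= 1 -> 0 <= (y - x) / (c - x) <= 1 -> `|x - y| < r -> f x - e < f y.
  move=> c01 xc.
  have d0 : 0 < `|c - x| by rewrite normr_gt0 subr_eq0 eq_sym.
  (* This radius forces [t * (f x + 1) < e] for the parameter [t] of [y] on the chord; the added 1
     keeps the divisor positive when [f x = 0]. *)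
  exists (e / (f x + 1) * `|c - x|); first by rewrite mulr_gt0// divr_gt0.
  move=> y y01 /andP[t0 t1] xy.
  set t := (y - x) / (c - x) in t0 t1.
  have tE : y = (1 - t) * x + t * c.
    by rewrite /t; field; rewrite subr_eq0 eq_sym.
  have t1' : 0 <= 1 - t by rewrite subr_ge0.
  have := hypo_concave x01 c01 t1' t0 (subrK _ _).
  rewrite -tE; apply: lt_le_trans.
  have fc := f_ge0 c01.
  have tc : 0 <= t * f c by rewrite mulr_ge0.
  have te : t * (f x + 1) < e.
    rewrite -ltr_pdivlMr//.
    have -> : t = `|x - y| / `|c - x|.
      by rewrite -normf_div -[LHS]ger0_norm// /t -[in RHS]normrN -mulNr opprB.
    by rewrite ltr_pdivrMr.
  by nra.
have [x1|x1] := eqVneq x 1; have [x0|x0] := eqVneq x 0.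
- by move: x1; rewrite x0 => /eqP; rewrite eq_sym oner_eq0.
- have [|r r0 rP] := side 0 _ x0; first by rewrite lexx ler01.
  exists r => // y y01 xy; apply: rP => //.
  by rewrite x1 sub0r invrN invr1 mulrN1; lra.
- have [|r r0 rP] := side 1 _ x1; first by rewrite lexx ler01.
  exists r => // y y01 xy; apply: rP => //.
  by rewrite x0 !subr0 divr1.
have [|r r0 rP] := side 0 _ x0; first by rewrite lexx ler01.
have [|s s0 sP] := side 1 _ x1; first by rewrite lexx ler01.
have xgt0 : 0 < x by rewrite lt_neqAle eq_sym x0; case/andP: x01.
have xlt1 : x < 1 by rewrite lt_neqAle x1; case/andP: x01.
exists (Num.min r s); first by rewrite lt_min r0.
move=> y /[dup] y01 /andP[y0 y1]; rewrite lt_min => /andP[xr xs].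
have [yx|xy] := leP y x.
- apply: rP => //.
  have -> : (y - x) / (0 - x) = (x - y) / x by field; rewrite gt_eqF.
  by rewrite divr_ge0 ?ler_pdivrMr//=; lra.
- apply: sP => //.
  by rewrite divr_ge0 ?ler_pdivrMr//=; lra.
Qed.

Lemma hypo_unif (e : R) : 0 < e -> exists2 d : R, 0 < d &
  forall x y : R, 0 <= x <= 1 -> 0 <= y <= 1 -> `|x - y| < d -> f x <= f y + e.
Proof.
move=> e0.
pose P (d x : R) := 0 <= x <= 1 -> forall y : R, 0 <= y <= 1 -> `|x - y| < d -> f x <= f y + e.
have cI : compact (`[0, 1]%classic : set R) by exact: segment_compact.
(* Compactness of the interval turns radii depending on the point into one [d], taken along the
   positive reals near 0. *)
have /compact_near_coveringP/(_ R 0^'+ P _) := cI.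
case.
  move=> z; rewrite /= in_itv/= => z01; pose x : R := z; have x01 : 0 <= x <= 1 by [].
  have e2 : 0 < e / 2 by rewrite divr_gt0.
  have [r r0 rP] := hypo_usc x01 e2.
  have [s s0 sP] := hypo_lsc x01 e2.
  (* Half the radius, since [y] is reached from [x] through [x'] in two steps of length below
     [q]. *)
  pose q := Num.min r s / 2.
  have q0 : 0 < q by rewrite divr_gt0// lt_min r0.
  have qr : q + q <= r by rewrite /q -splitr ge_min lexx.
  have qs : q + q <= s by rewrite /q -splitr ge_min lexx orbT.
  near=> x' d => x'01 y y01 xy.
  have dq : d < q by near: d; exact: nbhs_right_lt.
  have xq : `|x - x'| < q by near: x'; exact: (@nbhsx_ballx R R x q q0).
  have H1 : f x' < f x + e / 2 by apply: rP => //; lra.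
  have H2 : f x - e / 2 < f y.
    apply: sP => //; apply: le_lt_trans (ler_distD x' _ _) _.
    exact: lt_le_trans (ltrD xq (lt_trans xy dq)) qs.
  by lra.
move=> D D0 DP; exists (D / 2); first by rewrite divr_gt0.
move=> x y x01 y01 xy.
have D2 : 0 < D / 2 by rewrite divr_gt0.
apply: (DP (D / 2) _ D2 x _ x01 y y01 xy).
- by rewrite /ball_/= sub0r normrN gtr0_norm// gtr_pMr// invf_lt1// ltr1n.
- by rewrite /= in_itv.
Unshelve. all: by end_near.
Qed.
End ConcaveRegion.

(** * The bound for regions under concave graphs *)

Section RegionBound.
Context {R : realType}.
Variable B : set (R * R).
Hypothesis bB : body B.
Hypothesis B_ge0 : forall s t, B (s, t) -> 0 <= s /\ 0 <= t.
Local Notation Cp := (darea B std_triangle / rarea std_triangle).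

(** A right triangle with apex over 0, the case [w = 0] of [good_height_tent]; zero height is
    treated apart because that lemma asks for a positive one. *)
Lemma good_height_left (c : R) : 0 <= c -> good_height B (fun x => c * (1 - x)).
Proof.
rewrite le_eqVlt => /predU1P[<-|c0].
  by apply: (good_height_eq _ (good_height_zero bB B_ge0)) => x _; rewrite mul0r.
apply: (@good_height_tent _ _ bB B_ge0 0 c) => //; first by rewrite lexx ler01.
by move=> x y /andP[x0 x1] y0; rewrite mulr0 subr0 mulr1 mulr_ge0// ltW.
Qed.

Lemma good_height_right (c : R) : 0 <= c -> good_height B (fun x => c * x).
Proof.
rewrite le_eqVlt => /predU1P[<-|c0].
  by apply: (good_height_eq _ (good_height_zero bB B_ge0)) => x _; rewrite mul0r.
apply: (@good_height_tent _ _ bB B_ge0 1 c) => //; first by rewrite lexx ler01.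
move=> x y /andP[x0 x1] y0; rewrite mulr1 subrr mulr0 mulr_ge0 ?andbT ?subr_ge0//.
exact: ltW.
Qed.

Lemma good_height_scaled_tent (c w : R) : 0 < w < 1 -> 0 <= c ->
  good_height B (fun x => c * tent w x).
Proof.
move=> /andP[w0 w1]; rewrite le_eqVlt => /predU1P[<-|c0].
  by apply: (good_height_eq _ (good_height_zero bB B_ge0)) => x _; rewrite mul0r.
have w2 : 0 < 1 - w by rewrite subr_gt0.
apply: (@good_height_tent _ _ bB B_ge0 w (c * w * (1 - w))) => //.
- by rewrite !ltW.
- by rewrite !mulr_gt0.
move=> x y x01 y0; rewrite /tent (minr_pMr _ _ (ltW c0)) le_min; congr andb.
- have -> : c * w * (1 - w) * x = (c * (x * (1 - w))) * w by ring.
  by rewrite ler_pM2r.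
- have -> : c * w * (1 - w) * (1 - x) = (c * (w * (1 - x))) * (1 - w) by ring.
  by rewrite ler_pM2r.
Qed.

Lemma good_height_sum (n : nat) (g : 'I_n -> R -> R) : (forall i, good_height B (g i)) ->
  good_height B (fun x => \sum_(i < n) g i x).
Proof.
elim: n g => [|n IH] g gg.
  by apply: (good_height_eq _ (good_height_zero bB B_ge0)) => x _; rewrite big_ord0.
apply: (good_height_eq (f := fun x => \sum_(i < n) g (widen_ord (leqnSn n) i) x + g ord_max x)).
  by move=> x _; rewrite big_ord_recr.
by apply: good_height_add => //; exact: IH.
Qed.

(** Concavity of the sequence makes all tent coefficients nonnegative. *)
Lemma good_height_interp (m : nat) (F : nat -> R) :
  (forall i, (i < m)%N -> F i + F i.+2 <= 2 * F i.+1) -> 0 <= F 0%N -> 0 <= F m.+1 ->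
  good_height B (interp m F).
Proof.
move=> F2 F0 Fm; rewrite /interp.
apply: good_height_add => //; first apply: good_height_add => //.
- exact: good_height_left.
- exact: good_height_right.
apply: good_height_sum => i; apply: good_height_scaled_tent.
  rewrite /node divr_gt0// ltr_pdivrMr// mul1r ltr_nat ltnS.
  exact: ltn_ord.
rewrite mulr_ge0//.
have := F2 i (ltn_ord i); lra.
Qed.

(** For an interpolant [g] with [f - e <= g <= f], the good height [g + e] lies between [f] and
    [f + e]. Monotonicity of both areas then gives the bound up to [e] times a constant, without
    continuity of [darea]. *)
Lemma darea_hypo_le (f : R -> R) : (forall x : R, 0 <= x <= 1 -> 0 <= f x) -> body (hypo f) ->
  darea B (hypo f) <= Cp * rarea (hypo f).
Proof.
move=> f0 bf.
have sq : body (hypo (fun _ : R => 1)) by exact: (body_box 0 1 0 1).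
suff H (e : R) : 0 < e ->
    darea B (hypo f) <= Cp * (rarea (hypo f) + e * rarea (hypo (fun _ : R => 1))).
  have Q0 : 0 <= Cp * rarea (hypo (fun _ : R => 1)) by rewrite mulr_ge0 ?Cp_ge0 ?rarea_ge0.
  apply/ler_addgt0Pr => e e0.
  (* The added 1 keeps the divisor positive even if the constant vanishes. *)
  have k0 : 0 < e / (Cp * rarea (hypo (fun _ : R => 1)) + 1).
    by rewrite divr_gt0// ltr_wpDl.
  apply: (le_trans (H _ k0)); rewrite mulrDr lerD2l mulrCA.
  rewrite mulrAC ler_pdivrMr; last by rewrite ltr_wpDl.
  by rewrite ler_pM2l// lerDl.
move=> e0.
have [d d0 dP] := hypo_unif f0 bf e0.
have [m md] : exists m : nat, m.+1%:R^-1 < d.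
  exists (Num.truncn d^-1); rewrite invf_plt ?posrE//.
  have /andP[_] := truncn_itv (ltW (etrans (invr_gt0 d) d0)).
  exact.
pose F j : R := f (node m j).
have nodeb j : (j <= m.+1)%N -> 0 <= (node m j : R) <= 1.
  move=> jm; rewrite -[X in _ && (_ <= X)](@node_last R m).
  by rewrite -[X in (X <= _) && _](@node0 R m) !node_le.
pose g := interp m F.
have gP (x : R) : 0 <= x <= 1 -> f x - e <= g x /\ g x <= f x.
  move=> x01; have [j [a [b [jm a0 b0 ab xE]]]] := cell_exists m x01.
  have n1 := nodeb j (leqW jm); have n2 := nodeb j.+1 jm.
  have nS := @nodeS R m j.
  have gE : g x = a * F j + b * F j.+1 by rewrite /g xE interp_cell.
  have i0 : 0 < (m.+1%:R : R)^-1 by rewrite invr_gt0.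
  have i0' := ltW i0.
  have aE : a = 1 - b by lra.
  have a1 : a <= 1 by lra.
  have b1 : b <= 1 by lra.
  split; rewrite gE /F.
    have D1 : f x <= f (node m j) + e.
      apply: dP => //.
      have -> : x - node m j = b * m.+1%:R^-1 by rewrite xE nS aE; ring.
      by rewrite ger0_norm ?mulr_ge0//; apply: le_lt_trans md; rewrite ler_piMl.
    have D2 : f x <= f (node m j.+1) + e.
      apply: dP => //; rewrite distrC.
      have -> : node m j.+1 - x = a * m.+1%:R^-1 by rewrite xE nS aE; ring.
      by rewrite ger0_norm ?mulr_ge0//; apply: le_lt_trans md; rewrite ler_piMl.
    have : a * f x + b * f x <= a * (f (node m j) + e) + b * (f (node m j.+1) + e).
      by rewrite lerD// ler_wpM2l.
    by rewrite -mulrDl ab mul1r aE; lra.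
  by rewrite xE; exact: hypo_concave.
(* The constant [e] is written as a sum of two right triangles, which are good heights. *)
have gg : good_height B (fun x => g x + (e * (1 - x) + e * x)).
  apply: good_height_add => //.
    apply: good_height_interp; rewrite /F.
    - move=> i im; have h0 : (0 : R) <= 1 / 2 by lra.
      have h1 : (1 : R) / 2 + 1 / 2 = 1 by lra.
      have i1 : (i <= m.+1)%N by lia.
      have i2 : (i.+2 <= m.+1)%N by lia.
      have := hypo_concave f0 bf (nodeb _ i1) (nodeb _ i2) h0 h0 h1.
      have -> : 1 / 2 * (node m i : R) + 1 / 2 * node m i.+2 = node m i.+1.
        by rewrite !nodeS; move: (node m i : R) (m.+1%:R^-1 : R) => u v; lra.
      by lra.
    - by apply: f0; exact: nodeb.
    - by apply: f0; exact: nodeb.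
  apply: good_height_add => //.
  - exact: good_height_left (ltW e0).
  - exact: good_height_right (ltW e0).
have [G0 bG dG] := gg.
apply: (le_trans (y := darea B (hypo (fun x => g x + (e * (1 - x) + e * x))))).
  apply: le_darea => // -[x y] [/= x01 /andP[y0 yf]]; split => //=.
  rewrite y0/=; have [H _] := gP _ x01; lra.
apply: (le_trans dG); rewrite ler_wpM2l ?Cp_ge0//.
have -> : rarea (hypo f) + e * rarea (hypo (fun _ : R => 1)) =
    rarea (hypo (fun x => f x + e * 1)).
  have E : hypo (fun _ : R => e * 1) = vaffine e 0 0 @` hypo (fun _ : R => 1).
    rewrite eqEsubset; split => [[x y] [/= x01 /andP[y0 y1]]|_ [[x y] [/= x01 /andP[y0 y1]] <-]].
      exists (x, y / e); last by rewrite /vaffine/=; congr pair; field; rewrite gt_eqF.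
      by split => //=; rewrite divr_ge0 ?(ltW e0)//= ler_pdivrMr// mul1r -[leRHS]mulr1.
    by split => //=; rewrite mul0r !addr0 mulr_ge0 ?(ltW e0)//= ler_pM2l.
  rewrite (@rarea_hypo_add _ f (fun _ => e * 1))//.
  - by rewrite E rarea_vaffine// gtr0_norm.
  - by move=> x _; rewrite mulr1 ltW.
  - by rewrite E; exact: body_vaffine.
have bfe : body (hypo (fun x => f x + e * 1)).
  rewrite hypo_add//; last by move=> x _; rewrite mulr1 ltW.
  apply: body_fiber_sum => //.
  have -> : hypo (fun _ : R => e * 1) = box 0 1 0 (e * 1) by [].
  exact: body_box.
apply: le_rarea; [exact: bG.1|exact: bfe.1|].
move=> [x y] [/= x01 /andP[y0 yf]]; split => //=.
by rewrite y0/=; have [_ H] := gP _ x01; lra.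
Qed.

End RegionBound.

(** * The upper bound *)

Section Bound.
Context {R : realType}.
Variable B : set (R * R).
Hypothesis bB : body B.
Hypothesis B_ge0 : forall s t, B (s, t) -> 0 <= s /\ 0 <= t.
Local Notation Cp := (darea B std_triangle / rarea std_triangle).
Implicit Types K : set (R * R).

(** Multiplied out, so that it is meaningful for bodies of area zero as well. *)
Definition bounded_ratio K := darea B K <= Cp * rarea K.

Lemma bounded_ratio_lin a b c d K : body K -> a * d - b * c != 0 ->
  bounded_ratio (lin a b c d @` K) -> bounded_ratio K.
Proof.
move=> bK D0; rewrite /bounded_ratio darea_lin// rarea_lin// mulrCA ler_pM2l//.
by rewrite normr_gt0.
Qed.

Lemma bounded_ratio_swap K : body K -> bounded_ratio (swap_coord @` K) -> bounded_ratio K.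
Proof.
move=> bK; rewrite swap_lin; apply: bounded_ratio_lin bK _.
by rewrite mul0r mul1r sub0r oppr_eq0 oner_eq0.
Qed.

Lemma bounded_ratio_vaffine c m K : body K -> c != 0 ->
  bounded_ratio (vaffine c m 0 @` K) -> bounded_ratio K.
Proof.
move=> bK c0; rewrite vaffine_lin; apply: bounded_ratio_lin bK _.
by rewrite mul0r mul1r subr0.
Qed.

Lemma strip_axis K x : body K -> K (0, 0) -> K (1, 0) -> 0 <= x <= 1 -> K (x, 0).
Proof.
move=> bK K0 K1 /andP[x0 x1].
have := bK.2 _ _ (1 - x) x K0 K1; rewrite /= !mulr0 addr0 add0r mulr1.
by apply; lra.
Qed.

(** [K] contains the axis segment from [(0, 0)] to [(1, 0)], so every section over it meets the axis
    and the upper part is the region under the upper boundary [f]. *)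
Lemma bounded_ratio_upper K : body K -> (forall z, K z -> 0 <= z.1 <= 1) ->
  K (0, 0) -> K (1, 0) ->
  bounded_ratio (K `&` [set z | 0 <= z.2]) /\ body (K `&` [set z | 0 <= z.2]).
Proof.
move=> bK K01 K0 K1.
pose f x := sup (xsection K x).
have sec x : 0 <= x <= 1 -> exists a, [/\ a <= 0, 0 <= f x &
    forall y, K (x, y) <-> a <= y <= f x].
  move=> x01; have Kx := strip_axis bK K0 K1 x01.
  have [E|[a [b [ab E]]]] := body_xsection x bK.
    by move/xsectionP : Kx; rewrite E.
  have Ky y : K (x, y) <-> a <= y <= b.
    split=> [/xsectionP|yab]; first by rewrite E/= in_itv.
    by apply/xsectionP; rewrite E/= in_itv.
  have fb : f x = b by rewrite /f E sup_itvcc.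
  by exists a; rewrite fb; have /andP[] := (Ky 0).1 Kx; split.
have E : K `&` [set z | 0 <= z.2] = hypo f.
  rewrite eqEsubset; split => -[x y] [/=].
    move=> Kxy y0; have x01 := K01 _ Kxy; have [a [_ _ /(_ y)[/(_ Kxy)]]] := sec _ x01.
    by move=> /andP[_ yf] _; split => //=; rewrite y0.
  move=> x01 /andP[y0 yf]; have [a [a0 _ /(_ y)[_ H]]] := sec _ x01.
  by split => //=; apply: H; rewrite yf (le_trans a0).
have bE : body (K `&` [set z | 0 <= z.2]).
  have -> : K `&` [set z | 0 <= z.2] = K `&` [set z | 0 * z.1 + (-1) * z.2 + 0 <= 0].
    rewrite eqEsubset; split => z [Kz /= z2]; split => //=; lra.
  exact: body_halfplane.
rewrite E in bE *; split => //.
by apply: darea_hypo_le => // x x01; have [a []] := sec _ x01.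
Qed.

Lemma bounded_ratio_strip K : body K -> (forall z, K z -> 0 <= z.1 <= 1) ->
  K (0, 0) -> K (1, 0) -> bounded_ratio K.
Proof.
move=> bK K01 K0 K1.
have [bu bKu] := bounded_ratio_upper bK K01 K0 K1.
(* The part below the axis is handled by reflecting it upwards and back. *)
pose K' := vaffine (-1) 0 0 @` K.
have bK' : body K' by exact: body_vaffine.
have [|||bl bKl] := bounded_ratio_upper bK'.
- by move=> _ [z Kz <-]; exact: (K01 z Kz).
- by exists (0, 0) => //; rewrite /vaffine/=; congr pair; ring.
- by exists (1, 0) => //; rewrite /vaffine/=; congr pair; ring.
set Ku := K `&` _ in bu bKu.
set Kl' := K' `&` _ in bl bKl.
pose Kl := vaffine (-1) 0 0 @` Kl'.
have bl' : body Kl by exact: body_vaffine.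
have KlP x y : Kl (x, y) <-> K (x, y) /\ y <= 0.
  split=> [[_ [[[u v] Kuv <-] /= v0] [<- <-]]|[Kxy y0]].
    rewrite /vaffine/= in v0 *; have -> : -1 * (-1 * v + 0 * u + 0) + 0 * u + 0 = v by ring.
    by split => //; lra.
  exists (vaffine (-1) 0 0 (x, y)); last by rewrite /vaffine/=; congr pair; ring.
  by split; [exists (x, y)|rewrite /vaffine/=; lra].
have lK : bounded_ratio Kl.
  by rewrite /bounded_ratio darea_vaffine// rarea_vaffine// normrN normr1 !mul1r.
have arK : rarea K = rarea Ku + rarea Kl.
  apply: rarea_sections_add; [exact: bK.1|exact: bKu.1|exact: bl'.1|move=> x].
  rewrite /seclen.
  have [E|[a [b [ab E]]]] := body_xsection x bK.
    rewrite E measure0.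
    have -> : xsection Ku x = set0.
      by rewrite -subset0 => y /xsectionP[Kxy _]; move/xsectionP: Kxy; rewrite E.
    have -> : xsection Kl x = set0.
      by rewrite -subset0 => y /xsectionP/KlP[Kxy _]; move/xsectionP: Kxy; rewrite E.
    by rewrite measure0 adde0.
  have Ky y : K (x, y) <-> a <= y <= b.
    split=> [/xsectionP|yab]; first by rewrite E/= in_itv.
    by apply/xsectionP; rewrite E/= in_itv.
  have Kxa : K (x, a) by apply/Ky; rewrite lexx.
  have /andP[a0 b0] := (Ky 0).1 (strip_axis bK K0 K1 (K01 _ Kxa)).
  have -> : xsection Ku x = `[0, b]%classic.
    rewrite eqEsubset; split => y.
      by move=> /xsectionP[/Ky/andP[_ yb] /= y0]; rewrite in_itv/= y0.
    rewrite /= in_itv/= => /andP[y0 yb]; apply/xsectionP; split => //.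
    by apply/Ky; rewrite yb (le_trans a0).
  have -> : xsection Kl x = `[a, 0]%classic.
    rewrite eqEsubset; split => y.
      by move=> /xsectionP/KlP[/Ky/andP[ya _] y0]; rewrite /= in_itv/= ya.
    rewrite /= in_itv/= => /andP[ya y0]; apply/xsectionP/KlP; split => //.
    by apply/Ky; rewrite ya (le_trans y0).
  rewrite E (lebesgue_itv ab) (lebesgue_itv a0) (lebesgue_itv b0) -EFinD.
  by congr EFin; ring.
rewrite /bounded_ratio arK mulrDr; apply: (le_trans _ (lerD bu lK)).
apply: darea_fiber_sum => // x y Kxy.
have Kx0 := strip_axis bK K0 K1 (K01 _ Kxy).
have [y0|y0] := leP 0 y.
- exists y, 0; split; rewrite ?addr0//.
  by apply/KlP.
- exists 0, y; split; rewrite ?add0r//; last by apply/KlP; split => //; exact: ltW.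
  by split => //=.
Qed.

(** After the swap the body is horizontal, hence fixed by the vertical map of factor 0, and [darea]
    vanishes. *)
Lemma bounded_ratio_line K : body K -> (forall z, K z -> z.1 = 0) -> bounded_ratio K.
Proof.
move=> bK Kx; rewrite /bounded_ratio.
have bS := body_swap bK.
rewrite -(darea_swap bB B_ge0 bK).
have -> : swap_coord @` K = vaffine 0 0 0 @` (swap_coord @` K).
  rewrite image_comp; apply: eq_imagel => z Kz.
  by rewrite /vaffine/swap_coord/= (Kx _ Kz) !mul0r !addr0.
by rewrite darea_vaffine// normr0 mul0r mulr_ge0 ?rarea_ge0// Cp_ge0.
Qed.

Lemma bounded_ratio_halfplane K : body K -> (forall z, K z -> 0 <= z.1) ->
  K (0, 0) -> bounded_ratio K.
Proof.
move=> bK Kx K0.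
have cf : {within K, continuous (@fst R R)}.
  by apply: continuous_subspaceT => z; exact: cvg_fst.
have [|[b c] Kbc bmax] := compact_EVT_max _ bK.1 cf; first by exists (0, 0).
rewrite inE in Kbc.
have b0 : 0 <= b by exact: Kx Kbc.
have [bE|bn0] := eqVneq b 0.
  apply: bounded_ratio_line => // z Kz.
  have := bmax z; rewrite inE => /(_ Kz) /=; have := Kx z Kz.
  by rewrite bE => *; apply/eqP; rewrite eq_le; apply/andP.
have bgt0 : 0 < b by rewrite lt_neqAle eq_sym bn0.
(* This matrix rescales the width to 1 and shears the rightmost point [(b, c)] to [(1, 0)]. *)
have D0 : b^-1 * 1 - 0 * (- c / b) != 0 by rewrite mulr1 mul0r subr0 invr_eq0.
apply: (bounded_ratio_lin bK D0); apply: bounded_ratio_strip.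
- exact: body_lin.
- move=> _ [z Kz <-]; rewrite /lin/= mul0r addr0.
  have := bmax z; rewrite inE => /(_ Kz) /= zb.
  by rewrite mulr_ge0 ?invr_ge0 ?Kx//= mulrC ler_pdivrMr// mul1r.
- by exists (0, 0) => //; rewrite /lin/=; congr pair; ring.
- by exists (b, c) => //; rewrite /lin/=; congr pair; field.
Qed.

(** The origin is the lowest point of its vertical chord, so some support line passes through it:
    the vertical axis if [K] lies on one side of it, otherwise a line of finite slope [m]. *)
Lemma bounded_ratio_bottom K : body K -> K (0, 0) ->
  (forall y, K (0, y) -> 0 <= y) -> bounded_ratio K.
Proof.
move=> bK K0 Ky.
have [[x1 [y1 [x10 K1]]]|nl] := pselect (exists x y, x < 0 /\ K (x, y)); last first.
  apply: bounded_ratio_halfplane => // -[x y] Kxy; rewrite leNgt; apply/negP => x0.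
  by apply: nl; exists x, y.
have [[x2 [y2 [x20 K2]]]|nr] := pselect (exists x y, 0 < x /\ K (x, y)); last first.
  have D0 : -1 * 1 - 0 * 0 != 0 :> R by rewrite mulr1 mul0r subr0 oppr_eq0 oner_eq0.
  apply: (bounded_ratio_lin bK D0); apply: bounded_ratio_halfplane.
  - exact: body_lin.
  - move=> _ [[x y] Kxy <-]; rewrite /lin/= mul0r addr0 mulN1r oppr_ge0 leNgt.
    by apply/negP => x0; apply: nr; exists x, y.
  - by exists (0, 0) => //; rewrite /lin/=; congr pair; ring.
(* The supremum of [S] is the slope of a support line of [K] at the origin. *)
pose S := [set s | exists x y, [/\ x < 0, K (x, y) & s = y / x]].
have slope x y x' y' : x < 0 -> K (x, y) -> 0 < x' -> K (x', y') -> y / x <= y' / x'.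
  move=> x0 Kxy x'0 Kxy'.
  have d0 : 0 < x' - x by lra.
  (* The height at which the segment joining the two points crosses the vertical axis. *)
  have H : 0 <= x' / (x' - x) * y + - x / (x' - x) * y'.
    apply: Ky; have := bK.2 _ _ (x' / (x' - x)) (- x / (x' - x)) Kxy Kxy'.
    rewrite /=; have -> : x' / (x' - x) * x + - x / (x' - x) * x' = 0.
      by field; rewrite gt_eqF.
    apply.
    - by rewrite divr_ge0 ?ltW.
    - by rewrite divr_ge0 ?ltW// oppr_gt0.
    - by field; rewrite gt_eqF.
  have : 0 <= (x' / (x' - x) * y + - x / (x' - x) * y') * (x' - x).
    by rewrite mulr_ge0// ltW.
  have -> : (x' / (x' - x) * y + - x / (x' - x) * y') * (x' - x) = x' * y - x * y'.
    by field; rewrite gt_eqF.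
  move=> H'; rewrite ler_ndivrMr// mulrAC ler_pdivrMr//; lra.
have hS : has_sup S.
  split; first by exists (y1 / x1), x1, y1.
  by exists (y2 / x2) => _ [x [y [x0 Kxy ->]]]; exact: slope.
pose m := sup S.
have mP x y : K (x, y) -> m * x <= y.
  move=> Kxy; have [x0|x0|xE] := ltgtP x 0.
  - rewrite -ler_ndivrMr//; apply: ub_le_sup; first exact: hS.2.
    by exists x, y.
  - rewrite -ler_pdivlMr//; apply: sup_le_ub; first exact: hS.1.
    by move=> _ [x' [y' [x'0 Kxy' ->]]]; exact: slope.
  - by rewrite xE mulr0; apply: Ky; rewrite -xE.
(* The shear makes the support line horizontal, and the swap makes it vertical. *)
apply: (@bounded_ratio_vaffine 1 (- m)) => //.
have bV := body_vaffine 1 (- m) 0 bK.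
apply: bounded_ratio_swap => //; apply: bounded_ratio_halfplane.
- exact: body_swap.
- move=> _ [_ [[x y] Kxy <-] <-]; rewrite /vaffine/swap_coord/=.
  by have := mP _ _ Kxy; lra.
- exists (0, 0) => //; exists (0, 0) => //; rewrite /vaffine/=; congr pair; ring.
Qed.

Lemma bounded_ratio_top K : body K -> K (0, 0) ->
  (forall y, K (0, y) -> y <= 0) -> bounded_ratio K.
Proof.
move=> bK K0 Ky.
apply: (@bounded_ratio_vaffine (-1) 0) => //.
apply: bounded_ratio_bottom.
- exact: body_vaffine.
- by exists (0, 0) => //; rewrite /vaffine/=; congr pair; ring.
- move=> y [[u v] Kuv [u0 <-]]; rewrite u0 in Kuv; have := Ky _ Kuv; lra.
Qed.

Lemma bounded_ratio_origin K : body K -> K (0, 0) -> bounded_ratio K.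
Proof.
move=> bK K0.
have [E|[g [f [gf E]]]] := body_xsection 0 bK.
  by move/xsectionP : K0; rewrite E.
have Ky y : K (0, y) <-> g <= y <= f.
  split=> [/xsectionP|yab]; first by rewrite E/= in_itv.
  by apply/xsectionP; rewrite E/= in_itv.
have /andP[g0 f0] := (Ky 0).1 K0.
have [gE|gn0] := eqVneq g 0.
  by apply: bounded_ratio_bottom => // y /Ky/andP[]; rewrite gE.
have gf' : 0 < f - g by rewrite subr_gt0 (lt_le_trans _ f0)// lt_neqAle gn0.
pose l := f / (f - g); pose n := - g / (f - g).
have l0 : 0 <= l by rewrite divr_ge0// ltW.
have n0 : 0 <= n by apply: divr_ge0; lra.
have ln : l + n = 1 by rewrite /l /n; field; rewrite gt_eqF.
(* The origin is the combination of [(0, g)] and [(0, f)] with weights [l], [n]. *)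
have lgn : l * g + n * f = 0 by rewrite /l /n; field; rewrite gt_eqF.
pose Kg := vaffine 1 0 (- g) @` K; pose Kf := vaffine 1 0 (- f) @` K.
have bg : body Kg by exact: body_vaffine.
have bf : body Kf by exact: body_vaffine.
have arg : rarea Kg = rarea K by rewrite rarea_vaffine// normr1 mul1r.
have arf : rarea Kf = rarea K by rewrite rarea_vaffine// normr1 mul1r.
have Hg : darea B Kg <= Cp * rarea K.
  rewrite -arg; apply: bounded_ratio_bottom => //.
    exists (0, g); first by apply/Ky; rewrite lexx.
    by rewrite /vaffine/=; congr pair; ring.
  move=> y [[u v] Kuv [u0 <-]]; rewrite u0 in Kuv.
  by move/Ky/andP : Kuv => [gv _]; lra.
have Hf : darea B Kf <= Cp * rarea K.
  rewrite -arf; apply: bounded_ratio_top => //.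
    exists (0, f); first by apply/Ky; rewrite lexx andbT.
    by rewrite /vaffine/=; congr pair; ring.
  move=> y [[u v] Kuv [u0 <-]]; rewrite u0 in Kuv.
  by move/Ky/andP : Kuv => [_ fv]; lra.
rewrite /bounded_ratio -[leRHS]mul1r -ln mulrDl.
apply: (le_trans _ (lerD (ler_wpM2l l0 Hg) (ler_wpM2l n0 Hf))).
(* The weights are absorbed into vertical scalings of the two translates; [l] may be 0, which
   [darea_vaffine] permits. *)
rewrite -{1}(ger0_norm l0) -{1}(ger0_norm n0).
rewrite -(darea_vaffine bB B_ge0 l 0 bg) -(darea_vaffine bB B_ge0 n 0 bf).
apply: darea_fiber_sum => //; [exact: body_vaffine|exact: body_vaffine|].
move=> x y Kxy; exists (l * (y - g)), (n * (y - f)); split.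
- exists (vaffine 1 0 (- g) (x, y)); first by exists (x, y).
  by rewrite /vaffine/=; congr pair; ring.
- exists (vaffine 1 0 (- f) (x, y)); first by exists (x, y).
  by rewrite /vaffine/=; congr pair; ring.
- have -> : l * (y - g) + n * (y - f) = (l + n) * y - (l * g + n * f) by ring.
  by rewrite ln lgn; ring.
Qed.

End Bound.

(** * Identification of the p-sum *)

Section PSum.
Context {R : realType}.
Implicit Types K M N : set (R * R).

Lemma support_max K (u : R * R) : compact K -> K !=set0 ->
  exists2 x, K x & Defs.support K u = dot x u /\ forall y, K y -> dot y u <= Defs.support K u.
Proof.
move=> cK K0.
have cf : {within K, continuous (fun x : R * R => dot x u)}.
  by apply: continuous_subspaceT; rewrite /dot; solve_continuous.
have [x Kx xmax] := compact_EVT_max K0 cK cf.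
rewrite inE in Kx.
have E : Defs.support K u = dot x u.
  apply/eqP; rewrite eq_le; apply/andP; split.
    apply: sup_le_ub; first by exists (dot x u), x.
    by move=> _ [y Ky <-]; apply: xmax; rewrite inE.
  apply: ub_le_sup; last by exists x.
  by exists (dot x u) => _ [y Ky <-]; apply: xmax; rewrite inE.
exists x => //; split => // y Ky.
by rewrite E; apply: xmax; rewrite inE.
Qed.

Lemma support_separation K x : body K -> K !=set0 -> ~ K x ->
  exists u, Defs.support K u < dot x u.
Proof.
move=> bK K0 Kx.
pose d2 (y : R * R) : R := (x.1 - y.1) * (x.1 - y.1) + (x.2 - y.2) * (x.2 - y.2).
have cf : {within K, continuous d2}.
  by apply: continuous_subspaceT; rewrite /d2; solve_continuous.
have [y Ky ymin] := compact_EVT_min K0 bK.1 cf.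
rewrite inE in Ky.
(* [y] is the point of [K] nearest to [x]. *)
pose u : R * R := (x.1 - y.1, x.2 - y.2).
exists u; have [z Kz [-> _]] := support_max u bK.1 K0.
have upos : 0 < d2 y.
  rewrite lt_neqAle; apply/andP; split; last by rewrite /d2 addr_ge0// -expr2 sqr_ge0.
  apply/eqP => d0; apply: Kx; suff -> : x = y by [].
  have /eqP : d2 y = 0 by [].
  rewrite /d2 -!expr2 paddr_eq0 ?sqr_ge0// !sqrf_eq0 !subr_eq0 => /andP[/eqP x1 /eqP x2].
  by rewrite (surjective_pairing x) (surjective_pairing y) x1 x2.
pose q := (z.1 - y.1) * u.1 + (z.2 - y.2) * u.2.
suff q0 : q <= 0 by move: q0 upos; rewrite /q /dot /u /d2 /=; lra.
rewrite leNgt; apply/negP => qpos.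
pose w := (z.1 - y.1) * (z.1 - y.1) + (z.2 - y.2) * (z.2 - y.2).
have w0 : 0 <= w by rewrite /w addr_ge0// -expr2 sqr_ge0.
(* Moving from [y] towards [z] by this fraction changes the squared distance to [x] by
   [- t * (2 * q - t * w)], and [t * (q + w) = q] makes this negative. *)
pose t := q / (q + w).
have qw : 0 < q + w by rewrite ltr_wpDr.
have t0 : 0 < t by rewrite divr_gt0.
have t1 : t <= 1 by rewrite ler_pdivrMr// mul1r lerDl.
have t1' : 0 <= 1 - t by rewrite subr_ge0.
have Kt := bK.2 _ _ (1 - t) t Ky Kz t1' (ltW t0) (subrK _ _).
have := ymin _ (mem_set Kt).
have -> : d2 ((1 - t) * y.1 + t * z.1, (1 - t) * y.2 + t * z.2) =
    d2 y - t * (2 * q - t * w) by rewrite /d2 /q /w /u/=; ring.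
rewrite lerBrDr gerDl leNgt mulr_gt0//.
have tw : t * (q + w) = q by rewrite /t; field; rewrite gt_eqF.
by have := mulr_gt0 t0 qpos; nra.
Qed.

Lemma support_inj M N : body M -> body N -> M !=set0 -> N !=set0 ->
  (forall u, Defs.support M u = Defs.support N u) -> M = N.
Proof.
move=> bM bN M0 N0 MN.
have sub (A C : set (R * R)) : body A -> body C -> A !=set0 -> C !=set0 ->
    (forall u, Defs.support A u = Defs.support C u) -> A `<=` C.
  move=> bA bC A0 C0 AC x Ax; apply: contrapT => Cx.
  have [u] := support_separation bC C0 Cx.
  have [y Ay [_ yA]] := support_max u bA.1 A0.
  by rewrite -AC ltNge yA.
by rewrite eqEsubset; split; apply: sub.
Qed.

Variable p : R.
Hypothesis p1 : 1 <= p.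

Let p0 : 0 < p. Proof. exact: lt_le_trans p1. Qed.

Definition pnorm (a b : R) : R := (a `^ p + b `^ p) `^ p^-1.

(* The nonnegative part of the unit ball of l_q, 1/p + 1/q = 1, described by
   duality so that p = 1 needs no separate treatment. *)
Definition pdual : set (R * R) := [set w | [/\ 0 <= w.1, 0 <= w.2 &
  forall a b, 0 <= a -> 0 <= b -> w.1 * a + w.2 * b <= pnorm a b]].

Lemma pdual_ge0 s t : pdual (s, t) -> 0 <= s /\ 0 <= t.
Proof. by case. Qed.

Lemma body_pdual : body pdual.
Proof.
split; last first.
  move=> x y l m [x1 x2 xP] [y1 y2 yP] l0 m0 lm; split => /=.
  - by rewrite addr_ge0// mulr_ge0.
  - by rewrite addr_ge0// mulr_ge0.
  - move=> a b a0 b0.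
    have := lerD (ler_wpM2l l0 (xP a b a0 b0)) (ler_wpM2l m0 (yP a b a0 b0)).
    rewrite -mulrDl lm mul1r; apply: le_trans.
    by rewrite le_eqVlt; apply/orP; left; apply/eqP; ring.
have -> : pdual = box 0 1 0 1 `&` \bigcap_(ab in [set ab : R * R | 0 <= ab.1 /\ 0 <= ab.2])
    [set w : R * R | w.1 * ab.1 + w.2 * ab.2 <= pnorm ab.1 ab.2].
  rewrite eqEsubset; split => [[s t] [/= s0 t0 st]|[s t] [[/= /andP[s0 s1] /andP[t0 t1]] st]].
    split; last by move=> [a b] [/= a0 b0]; exact: st.
    (* Testing the duality inequality on the unit vectors bounds both coordinates by 1. *)
    have := st 1 0 ler01 (lexx _); have := st 0 1 (lexx _) ler01.
    rewrite /pnorm !powR1 !powR0 ?gt_eqF// !(addr0, add0r) !powR1.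
    rewrite !(mulr0, mulr1, add0r, addr0) => t1 s1.
    by split; apply/andP.
  split => //= a b a0 b0.
  exact: (st (a, b)).
apply: compact_closedI; first exact: (body_box _ _ _ _).1.
apply: closed_bigI => -[a b] _.
by apply: closed_le_fun; solve_continuous.
Qed.

Lemma pnorm_ge0 a b : 0 <= pnorm a b. Proof. exact: powR_ge0. Qed.

(** The equality case of the Hölder inequality: for [p > 1] and nonzero norm [n] the maximizer is
    [(a, b)] with entries raised to the power [p - 1], divided by the same power of [n]. For [p = 1]
    it is [(1, 1)]. *)
Lemma pdual_attained a b : 0 <= a -> 0 <= b ->
  exists s t, pdual (s, t) /\ s * a + t * b = pnorm a b.
Proof.
move=> a0 b0.
have [pE|pn1] := eqVneq p 1.
  exists 1, 1; have E c d : 0 <= c -> 0 <= d -> 1 * c + 1 * d = pnorm c d.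
    by move=> c0 d0; rewrite /pnorm pE invr1 !powRr1 ?addr_ge0// !mul1r.
  by split; [split => //= c d c0 d0; rewrite E|exact: E].
have p1' : 1 < p by rewrite lt_neqAle eq_sym pn1.
have pm1 : 0 < p - 1 by rewrite subr_gt0.
pose q := p / (p - 1).
have q0 : 0 < q by rewrite divr_gt0.
have pq : p^-1 + q^-1 = 1 by rewrite /q invf_div; field; rewrite !gt_eqF.
pose n := pnorm a b.
have [nE|nn0] := eqVneq n 0.
  exists 0, 0; split; last by rewrite !mul0r addr0 -/n nE.
  by split => //= c d _ _; rewrite !mul0r addr0 pnorm_ge0.
have ngt0 : 0 < n by rewrite lt_neqAle eq_sym nn0 pnorm_ge0.
have np : n `^ p = a `^ p + b `^ p.
  by rewrite /n /pnorm -powRrM mulVf ?gt_eqF// powRr1// addr_ge0// powR_ge0.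
have key c : 0 <= c -> c `^ (p - 1) * c = c `^ p.
  rewrite le_eqVlt => /predU1P[<-|c0]; first by rewrite mulr0 powR0 ?gt_eqF.
  by rewrite -{2}(powRr1 (ltW c0)) -powRD ?subrK// implybE gt_eqF ?orbT.
pose r := n `^ (p - 1).
have r0 : 0 < r by rewrite powR_gt0.
exists (a `^ (p - 1) / r), (b `^ (p - 1) / r); split; last first.
  have -> : a `^ (p - 1) / r * a + b `^ (p - 1) / r * b =
    (a `^ (p - 1) * a + b `^ (p - 1) * b) / r by field; rewrite gt_eqF.
  by rewrite !key// -np -(key n (ltW ngt0)) -/r mulrAC mulfV ?gt_eqF// mul1r.
split; rewrite /=; try by rewrite divr_ge0 ?powR_ge0.
move=> c d c0 d0.
have H := hoelder2 (divr_ge0 (powR_ge0 a (p - 1)) (ltW r0)) (divr_ge0 (powR_ge0 b (p - 1)) (ltW r0))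
  c0 d0 q0 p0 (etrans (addrC _ _) pq).
apply: (le_trans H).
have pq' : (p - 1) * q = p by rewrite /q; field; rewrite gt_eqF.
have npn0 : n `^ p != 0 by rewrite gt_eqF// powR_gt0.
have rV : r^-1 `^ q = (n `^ p)^-1.
  apply: (mulIf npn0); rewrite mulVf// -[in X in _ * n `^ X]pq' powRrM -/r.
  by rewrite -powRM ?invr_ge0 ?(ltW r0)// mulVf ?gt_eqF// powR1.
have qE (c' : R) : 0 <= c' -> (c' `^ (p - 1) / r) `^ q = c' `^ p / n `^ p.
  by move=> c'0; rewrite powRM ?powR_ge0 ?invr_ge0 ?(ltW r0)// rV -powRrM pq'.
have S1 : (a `^ (p - 1) / r) `^ q + (b `^ (p - 1) / r) `^ q = 1.
  by rewrite (qE a a0) (qE b b0) -mulrDl -np; exact: mulfV.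
by rewrite S1 powR1 mul1r; exact: lexx.
Qed.

End PSum.

(** * The p-difference body, triangles at the origin, and the conclusion *)

Section Final.
Context {R : realType}.
Implicit Types K M N : set (R * R).

Lemma body_convex_body K : convex_body K <-> body K /\ K !=set0.
Proof.
split=> [[K0 cK /convex_setP vK]|[[cK vK] K0]]; first by [].
by split => //; apply/convex_setP.
Qed.

Variable p : R.
Hypothesis p1 : 1 <= p.

Lemma image_opp K : -%R @` K = lin (-1) 0 0 (-1) @` K.
Proof.
apply: eq_imagel => -[x y] _; rewrite /lin/=.
by rewrite !mul0r addr0 add0r !mulN1r.
Qed.

(** For fixed weights the support function of [s K - t K] is the combination of those of [K] and
    [-K]. The definition of [pdual] bounds it by [pnorm], and [pdual_attained] gives equality; both
    need nonnegative support values, which the origin in [K] provides. *)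
Lemma support_pdiff K u : body K -> K (0, 0) ->
  Defs.support (pdiff (pdual p) K) u =
  pnorm p (Defs.support K u) (Defs.support (-%R @` K) u).
Proof.
move=> bK K0.
have nK : K !=set0 by exists (0, 0).
have bN : body (-%R @` K) by rewrite image_opp; exact: body_lin.
have nN : (-%R @` K) !=set0 by apply: image_nonempty.
have [x Kx [xE xmax]] := support_max u bK.1 nK.
have [_ [y Ky <-] [yE ymax]] := support_max u bN.1 nN.
have a0 : 0 <= Defs.support K u.
  by have := xmax _ K0; rewrite /dot/= !mul0r addr0.
have b0 : 0 <= Defs.support (-%R @` K) u.
  have : (-%R @` K) (- (0, 0)) by exists (0, 0).
  by move=> /ymax; rewrite /dot/= !oppr0 !mul0r addr0.
have [s [t [Bst stE]]] := pdual_attained p1 a0 b0.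
have bD := body_pdiff (body_pdual p1) (@pdual_ge0 _ p) bK.
have Dz : pdiff (pdual p) K (s * x.1 - t * y.1, s * x.2 - t * y.2).
  by apply/pdiffP; exists s, t, x, y.
have [z /pdiffP[s' [t' [x' [y' [B' Kx' Ky' ->]]]]] [zE zmax]] :=
  support_max u bD.1 (ex_intro _ _ Dz).
apply/eqP; rewrite eq_le; apply/andP; split.
  have [s0 t0] := pdual_ge0 B'.
  have [_ _ /(_ _ _ a0 b0)] := B'; apply: le_trans.
  have h1 := ler_wpM2l s0 (xmax _ Kx').
  have h2 := ler_wpM2l t0 (ymax (- y') (imageP _ Ky')).
  apply: (le_trans _ (lerD h1 h2)); rewrite zE /dot /=.
  by rewrite le_eqVlt; apply/orP; left; apply/eqP; ring.
apply: (le_trans _ (zmax _ Dz)); rewrite -stE xE yE /dot /=.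
by rewrite le_eqVlt; apply/orP; left; apply/eqP; ring.
Qed.

(** [pdiff] witnesses that the choice in [psum] is made from a nonempty set, and a body is
    determined by its support function. *)
Lemma psum_opp K : body K -> K (0, 0) -> psum p K (-%R @` K) = pdiff (pdual p) K.
Proof.
move=> bK K0.
have bD := body_pdiff (body_pdual p1) (@pdual_ge0 _ p) bK.
have nD : pdiff (pdual p) K !=set0.
  exists (0, 0); apply/pdiffP; exists 0, 0, (0, 0), (0, 0); split => //.
    by split => //= a b _ _; rewrite !mul0r addr0 pnorm_ge0.
  by rewrite /= !mul0r subr0.
have H : is_psum p K (-%R @` K) (pdiff (pdual p) K).
  split; first by apply/body_convex_body.
  by move=> u; rewrite support_pdiff.
have [/body_convex_body[bM nM] ME] : is_psum p K (-%R @` K) (psum p K (-%R @` K)).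
  by apply: (@xgetPex _ set0); exists (pdiff (pdual p) K).
by apply: support_inj => // u; rewrite ME support_pdiff.
Qed.

Lemma FpE K : body K -> K (0, 0) -> Fp p K = darea (pdual p) K / rarea K.
Proof. by move=> bK K0; rewrite /Fp psum_opp. Qed.

Lemma triangle_lin (b c : R * R) T : is_triangle (0, 0) b c T ->
  b.1 * c.2 - c.1 * b.2 != 0 /\ T = lin b.1 c.1 b.2 c.2 @` std_triangle.
Proof.
case: b c => b1 b2 [c1 c2] [ncol ->] /=; split.
  apply/eqP => D0; apply: ncol.
  (* With zero determinant, a nonzero vertex turned by a right angle is normal to a line through all
     three vertices; if both vanish any normal works. *)
  have [/andP[/eqP b10 /eqP b20]|bn0] := boolP ((b1 == 0) && (b2 == 0)).
    have [/andP[/eqP c10 /eqP c20]|cn0] := boolP ((c1 == 0) && (c2 == 0)).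
      exists (1, 0), 0; rewrite /dot/= b10 b20 c10 c20 !mul0r addr0; split => //.
      by rewrite xpair_eqE oner_eq0.
    exists (- c2, c1), 0; rewrite /dot/= b10 b20 !mul0r addr0; split => //; last by ring.
    by rewrite xpair_eqE oppr_eq0 andbC.
  exists (- b2, b1), 0; rewrite /dot/= !mul0r addr0; split => //; last by lra.
    by rewrite xpair_eqE oppr_eq0 andbC.
  by ring.
set L := lin b1 c1 b2 c2.
have L0 : L (0, 0) = (0, 0) by rewrite /L/lin/=; congr pair; ring.
have L1 : L (1, 0) = (b1, b2) by rewrite /L/lin/=; congr pair; ring.
have L2 : L (0, 1) = (c1, c2) by rewrite /L/lin/=; congr pair; ring.
have [_ vL] : body (L @` std_triangle) by apply: body_lin; exact: body_std_triangle.
rewrite eqEsubset; split.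
  apply: smallest_sub; first exact/convex_setP.
  move=> _ [[->|->]|->].
  - by rewrite -L0; exists (0, 0) => //; split => /=; lra.
  - by rewrite -L1; exists (1, 0) => //; split => /=; lra.
  - by rewrite -L2; exists (0, 1) => //; split => /=; lra.
move=> _ [[x y] [/= x0 y0 xy] <-] M [/convex_setP vM sM].
have M0 : M (0, 0) by apply: sM; left; left.
have M1 : M (b1, b2) by apply: sM; left; right.
have M2 : M (c1, c2) by apply: sM; right.
have [x1|xn1] := eqVneq x 1.
  have yE : y = 0 by lra.
  by rewrite x1 yE L1.
have d0 : 0 < 1 - x by rewrite lt_neqAle eq_sym subr_eq0 eq_sym xn1; lra.
(* The three-point combination is built from two-point ones: first a point between the origin and
   the third vertex, then one between it and the second. *)
have N : M ((1 - x - y) / (1 - x) * 0 + y / (1 - x) * c1,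
            (1 - x - y) / (1 - x) * 0 + y / (1 - x) * c2).
  apply: (vM (0, 0) (c1, c2)) => //; try by apply: divr_ge0; lra.
  by field; rewrite gt_eqF.
have := vM _ _ x (1 - x) M1 N x0 (ltW d0) (subrKC _ _).
rewrite /L /lin /=.
set u := x * b1 + _; set v := x * b2 + _.
have -> : u = b1 * x + c1 * y by rewrite /u; field; rewrite gt_eqF.
have -> : v = b2 * x + c2 * y by rewrite /v; field; rewrite gt_eqF.
by [].
Qed.

Lemma open_lt_fun (f g : R * R -> R) : continuous f -> continuous g ->
  open [set x | f x < g x].
Proof.
move=> cf cg.
have -> : [set x | f x < g x] = ~` [set x | g x <= f x].
  by rewrite eqEsubset; split => x /=; rewrite ltNge => /negP.
by apply: closed_openC; exact: closed_le_fun.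
Qed.

Lemma interior_lin_std_triangle (a b c d : R) : a * d - b * c != 0 ->
  interior (lin a b c d @` std_triangle) !=set0.
Proof.
move=> D0; set D := a * d - b * c in D0.
pose V := lin (d / D) (- b / D) (- c / D) (a / D).
have LV z : lin a b c d (V z) = z.
  by case: z => x y; rewrite /V /lin /=; congr pair; rewrite /D; field.
have VL z : V (lin a b c d z) = z.
  by case: z => x y; rewrite /V /lin /=; congr pair; rewrite /D; field.
(* The image of the open standard triangle, described through the inverse map [V]; the centroid lies
   in it. *)
pose U := [set z : R * R | 0 < (V z).1] `&` [set z | 0 < (V z).2] `&`
  [set z | (V z).1 + (V z).2 < 1].
have oU : open U.
  apply: openI; first apply: openI; apply: open_lt_fun; rewrite /V /lin; solve_continuous.
have nU : nbhs (lin a b c d (3^-1, 3^-1)) U.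
  apply: open_nbhs_nbhs; split => //; rewrite /U /setI /mkset VL /=.
  by split; first split; lra.
exists (lin a b c d (3^-1, 3^-1)); apply: filterS nU.
move=> z [[/= z1 z2] z12]; exists (V z); last exact: LV.
by split; exact: ltW.
Qed.

Lemma K02_body K : K02 K -> body K /\ K (0, 0).
Proof. by move=> [/body_convex_body[]]. Qed.

End Final.

Theorem theorem3p2 (R : realType) (p : R) (T : set (R * R)) :
  1 <= p ->
  (exists b c : R * R, is_triangle (0, 0) b c T) ->
  maximizer (Fp p) K02 T.
Proof.
move=> p1 [b [c /triangle_lin[D0 TE]]].
have bT : body T by rewrite TE; exact/body_lin/body_std_triangle.
have T00 : T (0, 0).
  rewrite TE; exists (0, 0); first by split => /=; lra.
  by rewrite /lin/= !mulr0 addr0.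
have KT : K02 T.
  split => //; last by rewrite TE; exact: interior_lin_std_triangle.
  by apply/body_convex_body; split => //; exists (0, 0).
split => // L /K02_body[bL L0].
have B_ge0 := @pdual_ge0 _ p.
have bB := body_pdual p1.
have := bounded_ratio_origin bB B_ge0 bL L0; rewrite /bounded_ratio => HL.
have arT : 0 < rarea T.
  rewrite TE rarea_lin//; last exact: body_std_triangle.
  by rewrite mulr_gt0 ?normr_gt0// rarea_std_triangle_gt0.
have FT : Fp p T = darea (pdual p) std_triangle / rarea std_triangle.
  rewrite FpE// -[LHS]/(darea (pdual p) T / rarea T).
  rewrite {1}TE darea_tri// -TE.
  by rewrite -mulrA mulfV ?mulr1// gt_eqF.
rewrite FT FpE//.
(* A quotient by zero is zero, so in the first case the claim is that the constant is
   nonnegative. *)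
have [L00|Ln0] := eqVneq (rarea L) 0.
  by rewrite L00 invr0 mulr0 Cp_ge0.
by rewrite ler_pdivrMr// lt_neqAle eq_sym Ln0 rarea_ge0.
Qed.
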